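(* Let $\mu$ be a nondegenerate Borel probability measure on the kale $\mathcal K$ satisfying $\int_{\mathcal K} d(\mathbf 0,p)\,d\mu(p)<\infty$, and let $(p_n)_{n\ge 1}$ be independent $\mathcal K$-valued random variables on a probability space $(\Omega,\mathcal A,\mathbb P)$, each with distribution $\mu$. Let $b_N$ be the barycenter of $p_1,\dots,p_N$. Exactly one of the following holds. (1) (Fully sticky) $\mu$ is fully sticky, the mean of $\mu$ is $\mathbf 0$, and there exists a random integer $N^*$ such that, $\mathbb P$-almost surely, $b_N(\omega)=\mathbf 0$ for all $N\ge N^*(\omega)$. (2) (Partly sticky) $\mu$ is partly sticky, the mean of $\mu$ is $\mathbf 0$, and $b_N(\omega)\to\mathbf 0$ almost surely as $N\to\infty$. Furthermore, if $[A,B]$ is the closed interval of angles $\theta$ with $m_{\theta,1}\ge 0$, and $I\subset\mathbb R/\alpha\mathbb Z$ is an open interval of angles containing $[A,B]$, then there exists a random integer $N^*$ such that, almost surely, $b_N(\omega)\in C_I$ for all $N\ge N^*(\omega)$. (3) (Nonsticky) $\mu$ is nonsticky, the mean $\bar b$ of $\mu$ is not $\mathbf 0$, and $b_N(\omega)\to\bar b$ almost surely as $N\to\infty$.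
   Context: Fix $\alpha>2\pi$. The kale is $\mathcal K=\big((0,\infty)\times(\mathbb R/\alpha\mathbb Z)\big)\cup\{\mathbf 0\}$; points are written $(r,\theta)$ with $r\ge 0$, $\theta\in\mathbb R/\alpha\mathbb Z$, and $(0,\theta)=\mathbf 0$ for every $\theta$. For angles put $|\theta'-\theta|=\min_{n\in\mathbb Z}|n\alpha+\theta'-\theta|$; when $|\theta'-\theta|\le\pi$, the symbol $\theta'-\theta$ denotes the unique representative in $[-\pi,\pi]$. The metric is $d((r_1,\theta_1),(r_2,\theta_2))^2=(r_1+r_2)^2$ if $|\theta_1-\theta_2|\ge\pi$ and $=r_1^2+r_2^2-2r_1r_2\cos|\theta_1-\theta_2|$ if $|\theta_1-\theta_2|\le\pi$; in particular $d(\mathbf 0,(r,\theta))=r$. Folding map: $F_\theta:\mathcal K\to\mathbb R^2$ sends $\mathbf 0$ to $0$ and, in polar coordinates on $\mathbb R^2$, $F_\theta(r',\theta')=(r',\theta'-\theta)$ if $r'>0$, $|\theta'-\theta|\le\pi$, and $F_\theta(r',\theta')=(r',\pi)$ if $r'>0$, $|\theta'-\theta|\ge\pi$. The folded first moment is $m_\theta=\int_{\mathcal K}F_\theta(p)\,d\mu(p)=(m_{\theta,1},m_{\theta,2})\in\mathbb R^2$ (cartesian coordinates). Let $K=\{\theta\in\mathbb R/\alpha\mathbb Z: m_{\theta,1}\ge 0\}$. The measure $\mu$ is fully sticky if $K=\emptyset$; partly sticky if $K\neq\emptyset$ and $m_{\theta,1}=0$ for all $\theta\in K$; nonsticky if $K$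 has non-empty interior and $m_{\theta,1}>0$ on $\mathrm{int}(K)$. In the partly sticky case $K$ is a closed interval $[A,B]$ of length $<\pi$ (possibly $A=B$). Nondegenerate means: $\mu(R_{\theta,\theta'})<1$ for all angles $\theta,\theta'$ with $|\theta-\theta'|\ge\pi$, where $R_{\theta,\theta'}=\{(r,\theta):r\ge 0\}\cup\{(r,\theta'):r\ge 0\}$. Mean: if $\mu$ is fully or partly sticky, its mean is $\mathbf 0$; if $\mu$ is nonsticky, its mean is $(m_{\theta',1},\theta')$, where $\theta'$ is the (unique) maximizer of $\theta\mapsto m_{\theta,1}$. Barycenter of points: $b_N=\operatorname{arg\,min}_{p\in\mathcal K}\frac1{2N}\sum_{n=1}^N d(p,p_n)^2$ (the minimizer exists and is unique). Sector: for an interval of angles $I$, $C_I=\{(r,\theta)\in\mathcal K: r\ge 0,\ \theta\in I\}$ (it contains $\mathbf 0$). *)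

(* Defs.v *)
From HB Require Import structures.
From mathcomp Require Import all_boot all_order all_algebra.
From mathcomp Require Import generic_quotient.
From mathcomp Require Import all_classical all_reals all_analysis.

Set Implicit Arguments.
Unset Strict Implicit.
Unset Printing Implicit Defensive.

Import Order.TTheory GRing.Theory Num.Theory.
Import numFieldNormedType.Exports.

Local Open Scope classical_set_scope.
Local Open Scope ring_scope.

Definition exactly_one (P1 P2 P3 : Prop) : Prop :=
  [\/ [/\ P1, ~ P2 & ~ P3], [/\ ~ P1, P2 & ~ P3] | [/\ ~ P1, ~ P2 & P3]].

Section Angles.
Context {R : realType}.
Implicit Types (alpha x y : R).

Definition angle_rel alpha : rel R :=
  fun x y => `[< exists n : int, y = n%:~R * alpha + x >].

Lemma angle_rel_refl alpha : reflexive (angle_rel alpha).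
Proof. by move=> x; apply/asboolP; exists 0; rewrite mul0r add0r. Qed.

Lemma angle_rel_sym alpha : symmetric (angle_rel alpha).
Proof.
suff imp x y : angle_rel alpha x y -> angle_rel alpha y x.
  by move=> x y; apply/idP/idP; exact: imp.
move=> /asboolP[n ->]; apply/asboolP; exists (- n).
by rewrite mulrNz mulNr addKr.
Qed.

Lemma angle_rel_trans alpha : transitive (angle_rel alpha).
Proof.
move=> y x z /asboolP[n ->] /asboolP[m ->]; apply/asboolP; exists (m + n).
by rewrite intrD mulrDl addrA.
Qed.

Canonical angle_equiv alpha : equiv_rel R :=
  EquivRel (angle_rel alpha) (@angle_rel_refl alpha) (@angle_rel_sym alpha)
    (@angle_rel_trans alpha).

(* R/alphaZ with the quotient topology *)
Definition angle alpha := quotient_topology {eq_quot angle_equiv alpha}%qT.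

HB.instance Definition _ alpha := Topological.on (angle alpha).

Definition angle_of alpha (x : R) : angle alpha :=
  \pi_({eq_quot angle_equiv alpha})%qT x.

(* all the real representatives of t' - t *)
Definition adiffs alpha (t' t : angle alpha) : set R :=
  [set x | exists a b : R, [/\ angle_of alpha a = t', angle_of alpha b = t &
                               x = a - b]].

(* |t' - t|; for alpha > 0 the infimum is attained *)
Definition adist alpha (t' t : angle alpha) : R :=
  inf [set `|x| | x in adiffs t' t].

(* the representative of t' - t in [-pi, pi], which exists when |t' - t| <= pi
   and is unique when 2 * pi < alpha *)
Definition adiff alpha (t' t : angle alpha) : R :=
  xget 0 (adiffs t' t `&` [set x | - pi <= x <= pi]).

(* the arcs from a to b, as the images of the intervals of the real line *)
Definition closed_arc alpha (a b : R) : set (angle alpha) :=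
  angle_of alpha @` [set x | a <= x <= b].

Definition open_arc alpha (a b : R) : set (angle alpha) :=
  angle_of alpha @` [set x | a < x < b].

End Angles.

Arguments closed_arc {R} alpha a b _.
Arguments open_arc {R} alpha a b _.

Section Kale.
Context {R : realType}.
Implicit Types alpha : R.

(* None is the origin *)
Definition kale alpha : Type := option ({r : R | 0 < r} * angle alpha).

HB.instance Definition _ alpha := Choice.on (kale alpha).
HB.instance Definition _ alpha := isPointed.Build (kale alpha) None.

Definition origin {alpha} : kale alpha := None.

(* the point (r, t) for r >= 0; junk value origin for r < 0 *)
Definition polar alpha (r : R) (t : angle alpha) : kale alpha :=
  if insub r is Some r' then Some (r', t) else origin.

Definition kdist alpha (p q : kale alpha) : R :=
  match p, q with
  | None, None => 0
  | None, Some (r, _) | Some (r, _), None => val r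
  | Some (r1, t1), Some (r2, t2) =>
      if adist t1 t2 <= pi then
        Num.sqrt (val r1 ^+ 2 + val r2 ^+ 2
                  - 2 * val r1 * val r2 * cos (adist t1 t2))
      else val r1 + val r2
  end.

Definition kale_open alpha : set (set (kale alpha)) :=
  [set U | forall p, U p ->
     exists2 e : R, 0 < e & forall q, kdist p q < e -> U q].

Definition polar_to_cartesian (r x : R) : R * R := (r * cos x, r * sin x).

Definition fold alpha (t : angle alpha) (p : kale alpha) : R * R :=
  if p is Some (r', t') then
    if adist t' t <= pi then polar_to_cartesian (val r') (adiff t' t)
    else polar_to_cartesian (val r') pi
  else (0, 0).

Definition ray alpha (t : angle alpha) : set (kale alpha) :=
  [set p | exists2 r : R, 0 <= r & p = polar r t].

Definition sector alpha (I : set (angle alpha)) : set (kale alpha) :=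
  [set p | exists r t, [/\ 0 <= r, I t & p = polar r t]].

(* half the mean of the squared distances from q to p 0, ..., p (N - 1) *)
Definition frechet alpha (N : nat) (p : nat -> kale alpha) (q : kale alpha) : R :=
  (2 * N%:R)^-1 * \sum_(n < N) kdist q (p n) ^+ 2.

(* for N = 0 every point is a minimizer, and this is an arbitrary one *)
Definition barycenter alpha (N : nat) (p : nat -> kale alpha) : kale alpha :=
  xget origin [set q | forall q', frechet N p q <= frechet N p q'].

End Kale.

Notation borel_kale alpha := (g_sigma_algebraType (@kale_open _ alpha)).

Section Moments.
Context {R : realType} {alpha : R}.
Variable mu : probability (borel_kale alpha) R.

Definition folded_moment (t : angle alpha) : R * R :=
  (\int[mu]_(p in [set: borel_kale alpha]) (fold t p).1,
   \int[mu]_(p in [set: borel_kale alpha]) (fold t p).2)%R.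

Definition nonneg_angles : set (angle alpha) :=
  [set t | 0 <= (folded_moment t).1].

Definition fully_sticky : Prop := nonneg_angles = set0.

Definition partly_sticky : Prop :=
  nonneg_angles !=set0 /\
  forall t, nonneg_angles t -> (folded_moment t).1 = 0.

Definition nonsticky : Prop :=
  interior nonneg_angles !=set0 /\
  forall t, interior nonneg_angles t -> 0 < (folded_moment t).1.

Definition nondegenerate_measure : Prop :=
  forall t t' : angle alpha, pi <= adist t t' ->
    (mu (ray t `|` ray t') < 1)%E.

Definition is_mean (b : kale alpha) : Prop :=
  ((fully_sticky \/ partly_sticky) /\ b = origin) \/
  (nonsticky /\
   exists2 t : angle alpha,
     forall t', t' <> t -> (folded_moment t').1 < (folded_moment t).1 &
     b = polar (folded_moment t).1 t).

End Moments.

Definition mutually_independent {d d'} {Omega : measurableType d}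
    {T : measurableType d'} {R : realType} (P : probability Omega R)
    (X : nat -> Omega -> T) : Prop :=
  forall (J : seq nat) (A : nat -> set T), uniq J ->
    (forall j, measurable (A j)) ->
    P (\bigcap_(j in [set` J]) (X j @^-1` A j)) =
    (\prod_(j <- J) P (X j @^-1` A j))%E.

(* Main.v *)
(** The squared distance from [(s, t)] to [p] is [s^2 + r^2 - 2 s F], where [r] is
    the radius of [p] and [F] the first coordinate of the folding of [p] at [t].
    Hence the barycenter of a sample is governed by its empirical folded moment
    [m_N]: it is the origin when [max m_N <= 0], and otherwise it is
    [(max m_N, argmax m_N)].  As [m_N] is Lipschitz with constant the mean
    radius, the strong law of large numbers on a finite net of angles makes
    [m_N] converge to the folded moment [m] uniformly, almost surely.

    It remains to describe [m].  In the angle, the first coordinate of the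
    folding map is a clipped cosine [c], which satisfies [c'' + c <= 0] weakly;
    so [m] lies above its trigonometric interpolant on every interval of length
    at most [pi].  Moreover [m t + m t' < 0] at distance more than [pi], by
    nondegeneracy.  These two facts give the shape of [{m >= 0}] and the
    uniqueness of the maximizer of a positive [m]. *)

From HB Require Import structures.
Require Import Defs.
From mathcomp Require Import all_boot all_order all_algebra.
From mathcomp Require Import all_classical all_reals all_analysis.
From mathcomp Require Import measurable_realfun measurable_fun_approximation.
From mathcomp Require Import ring lra.

Set Implicit Arguments.
Unset Strict Implicit.
Unset Printing Implicit Defensive.

Import Order.TTheory GRing.Theory Num.Theory.
Import numFieldNormedType.Exports.

Local Open Scope classical_set_scope.
Local Open Scope ring_scope.

(** At distance exactly pi the sum [m t + m t'] can vanish for a nondegenerate [mu], namely when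
    [mu] is carried by the half-plane sector between the two angles. In that case [m] is positive
    strictly inside the sector, and this is what keeps the arc of a partly sticky measure shorter
    than pi. The inequality [sin v * m (b - u) + sin u * m (b + v) <= sin (u + v) * m b] is the
    integrated form of [m'' + m <= 0]. It passes from the clipped cosine to its integral by
    monotonicity, without any differentiability of [m]. The indices [Nstar] are random variables, so
    the events that define them have to be measurable. Those events therefore involve finitely many
    angles and one bound on the mean radius, and the Lipschitz estimates extend them to all
    angles. *)

Section real_numbers.
Context {R : realType}.

Lemma ler_norm_of_sqr (a b : R) : 0 <= b -> a ^+ 2 <= b ^+ 2 -> `|a| <= b.
Proof.
by move=> b0 ab; rewrite -(@ler_pXn2r _ 2)// ?nnegrE// real_normK ?num_real.
Qed.

(** Compares the maxima [v] and [s] of two functions that are uniformly within [e]: [u] is the value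
    of the second function at the maximizer of the first, and [a] that of the first at the maximizer
    of the second. *)
Lemma max_perturbation (u v s a e : R) :
  - e < u - v -> u <= s -> s - a < e -> a <= v ->
  `|s - v| < e /\ v - 2 * e < a.
Proof. by move=> *; split; [rewrite ltr_norml; apply/andP; split|]; lra. Qed.

Lemma cos_le_homo (x y : R) : 0 <= x -> x <= y -> y <= pi -> cos y <= cos x.
Proof.
move=> x0 xy ypi; rewrite le_eqVlt; case: (eqVneq x y) => [->|xney].
  by rewrite eqxx.
rewrite ltr_cos ?in_itv/=; first by rewrite lt_neqAle xney xy orbT.
  by rewrite x0 (le_trans xy).
by rewrite (le_trans x0).
Qed.

Lemma dist_cos_le (x y : R) : `|cos x - cos y| <= `|x - y|.
Proof.
wlog xy : x y / x < y.
  move=> H; case: (ltgtP x y) => [|yx|->]; first exact: H.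
    by rewrite distrC [leRHS]distrC; exact: H.
  by rewrite !subrr.
have [c _ cE] := @MVT_segment _ cos (fun x => - sin x) _ _ (ltW xy)
  (fun z _ => is_derive_cos z)
  (continuous_subspaceT (fun z => @continuous_cos _ z)).
rewrite distrC cE normrM normrN distrC ler_piMl// ler_norml.
by rewrite sin_geN1 sin_le1.
Qed.

Lemma cos_piB (x : R) : cos (pi - x) = - cos x.
Proof. by rewrite cosB cospi sinpi mul0r addr0 mulN1r. Qed.

Lemma near_le_expr (b x : R) : 1 < b -> \forall n \near \oo, x <= b ^+ n.
Proof.
move=> b1; have b0 : 0 < b - 1 by rewrite subr_gt0.
have bernoulli n : 1 + n%:R * (b - 1) <= b ^+ n.
  elim: n => [|n IHn]; first by rewrite mul0r addr0 expr0.
  rewrite exprS (le_trans _ (ler_wpM2l _ IHn)) ?(ltW (lt_trans _ b1))//.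
  rewrite -subr_ge0 -natr1 (_ : _ - _ = n%:R * (b - 1) ^+ 2); last by ring.
  by rewrite mulr_ge0// sqr_ge0.
near=> n; apply: le_trans (bernoulli n); rewrite -lerBlDl -ler_pdivrMr//.
by near: n; exact: nbhs_infty_ger.
Unshelve. all: by end_near. Qed.

End real_numbers.

(** * A strong law of large numbers for pairwise independent variables *)

(* [psi] is the antiderivative of [min(1, x^2 / y^2)], whereas the left-hand side
   is [a min(1, x^2 / a^2)]. *)
Lemma minr_sqr_div_le_telescope (R : realType) (b x a : R) :
  1 < b -> 0 <= x -> 0 < a ->
  forall psi : R -> R,
    (forall y, psi y = if y <= x then y else 2 * x - x ^+ 2 / y) ->
  Num.min x a ^+ 2 / a <= b ^+ 2 / (b - 1) * (psi (b * a) - psi a).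
Proof.
move=> b1 x0 a0 psi psiE.
have b10 : 0 < b - 1 by rewrite subr_gt0.
have b0 : 0 < b by apply: lt_trans b1.
rewrite ler_pdivrMr// mulrAC -mulrA mulrAC ler_pdivlMr//; rewrite !psiE.
have ba0 : 0 < b * a by rewrite mulr_gt0.
have aba : a <= b * a by rewrite ler_peMl// ltW.
rewrite minElt.
case: ltP => xa.
- rewrite [b * a <= x]leNgt (lt_le_trans xa aba)/=.
  have -> : 2 * x - x ^+ 2 / (b * a) - (2 * x - x ^+ 2 / a) =
            x ^+ 2 * (b - 1) / (b * a).
    by field; rewrite !gt_eqF.
  rewrite (_ : b ^+ 2 * _ = x ^+ 2 * (b - 1) * b).
    by rewrite ler_peMr ?(ltW b1)// mulr_ge0 ?sqr_ge0// ltW.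
  by field; rewrite !gt_eqF.
- case: (leP (b * a) x) => bax.
    rewrite (_ : b ^+ 2 * _ = a ^+ 2 * (b - 1) * b ^+ 2); last by ring.
    by rewrite ler_peMr ?exprn_ege1 ?(ltW b1)// mulr_ge0 ?sqr_ge0// ltW.
  have -> : 2 * x - x ^+ 2 / (b * a) - a =
     (b - 1) / b ^+ 2 * a + ((x - a) * (b * a - x) + (x - a / b) * a * (b - 1)) / (b * a).
    by field; rewrite !gt_eqF.
  rewrite [a * (_ + _)]mulrDr [b ^+ 2 * (_ + _)]mulrDr -[leLHS]addr0 lerD//.
    by rewrite [leRHS](_ : _ = a ^+ 2 * (b - 1))//; field; rewrite gt_eqF.
  have ab : a / b <= a by rewrite ler_pdivrMr// ler_peMr// ltW.
  have ? := le_trans ab xa.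
  rewrite mulr_ge0 ?sqr_ge0// mulr_ge0 ?(ltW a0)// divr_ge0 ?(ltW ba0)//.
  by rewrite addr_ge0// !mulr_ge0 ?subr_ge0// ltW.
Qed.

(** The sum telescopes along [psi], whose values lie between [0] and [2 * x]. On [[b^n, b^(n+1)]],
    of length [(b - 1) * b^n], the derivative of [psi] drops by a factor of at most [b^2], whence
    [b^2 / (b - 1)]. *)
Lemma sum_minr_sqr_div_le (R : realType) (b x : R) (N : nat) :
  1 < b -> 0 <= x ->
  \sum_(0 <= n < N) Num.min x (b ^+ n) ^+ 2 / b ^+ n
    <= b ^+ 2 / (b - 1) * 2 * x.
Proof.
move=> b1 x0.
have b10 : 0 < b - 1 by rewrite subr_gt0.
have b0 : 0 < b by apply: lt_trans b1.
pose psi (y : R) := if y <= x then y else 2 * x - x ^+ 2 / y.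
have psi_ge0 (y : R) : 0 < y -> 0 <= psi y.
  move=> y0; rewrite /psi; case: (leP y x) => [_|xy]; first exact: ltW.
  rewrite subr_ge0 ler_pdivrMr// expr2 mulrAC ler_wpM2r//.
  by rewrite (le_trans (ltW xy))// ler_peMl ?ler1n// ltW.
have psi_le (y : R) : 0 < y -> psi y <= 2 * x.
  move=> y0; rewrite /psi; case: (leP y x) => [yx|xy].
    by rewrite (le_trans yx)// ler_peMl// ler1n.
  by rewrite gerBl divr_ge0 ?sqr_ge0// ltW.
apply: (@le_trans _ _ (\sum_(0 <= n < N)
  b ^+ 2 / (b - 1) * (psi (b ^+ n.+1) - psi (b ^+ n)))).
  apply: ler_sum => n _; rewrite [b ^+ n.+1]exprS.
  by apply: minr_sqr_div_le_telescope => //; rewrite exprn_gt0.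
rewrite -mulr_sumr telescope_sumr// -[leRHS]mulrA ler_wpM2l//.
  by rewrite divr_ge0 ?sqr_ge0// ltW.
by rewrite lerBlDr (le_trans (psi_le _ _)) ?lerDl ?psi_ge0 ?exprn_gt0.
Qed.

(** * Integrals on a probability space, Chebyshev's inequality and measurable random indices *)

Section probability_integrals.
Context {R : realType} {d : measure_display} {T : measurableType d}.
Variable Q : probability T R.

Lemma bounded_integrable
  (f : T -> R) (M : R) : measurable_fun setT f -> (forall x, `|f x| <= M) ->
  Q.-integrable setT (EFin \o f).
Proof.
move=> mf fM; apply: measurable_bounded_integrable => //.
  by rewrite (le_lt_trans (@probability_le1 _ _ _ Q _ measurableT)) ?ltry.
by exists M; split; [rewrite num_real|move=> x Mx y _/=; exact: le_trans (ltW Mx)].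
Qed.

Lemma Rintegral_probability_cst (c : R) : \int[Q]_x c = c.
Proof.
rewrite Rintegral_cst// (_ : fine _ = 1) ?mulr1//.
exact: (congr1 fine (probability_setT Q)).
Qed.

Lemma integrable_EFin_sum
    (I : Type) (s : seq I) (F : I -> T -> R) :
  (forall i, Q.-integrable setT (EFin \o F i)) ->
  Q.-integrable setT (EFin \o (fun w => \sum_(i <- s) F i w)).
Proof.
move=> iF.
rewrite (_ : _ \o _ = fun w => (\sum_(i <- s) (EFin \o F i) w)%E).
  exact: integrable_sum.
by apply/funext => w /=; rewrite sumEFin.
Qed.

Lemma Rintegral_sum
    (I : Type) (s : seq I) (F : I -> T -> R) :
  (forall i, Q.-integrable setT (EFin \o F i)) ->
  \int[Q]_w (\sum_(i <- s) F i w) = \sum_(i <- s) \int[Q]_w F i w.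
Proof.
move=> iF; elim: s => [|i s ih].
  rewrite big_nil; under eq_Rintegral do rewrite big_nil.
  by rewrite Rintegral_probability_cst.
rewrite big_cons -ih; under eq_Rintegral do rewrite big_cons.
by rewrite RintegralD//; exact: integrable_EFin_sum.
Qed.

Lemma chebyshev_sqr
    (Z : T -> R) (M c : R) :
  measurable_fun setT Z -> (forall x, `|Z x| <= M) -> 0 < c ->
  (Q [set x | (c <= `|Z x|)%R] <= (c ^- 2 * \int[Q]_x Z x ^+ 2)%:E)%E.
Proof.
move=> mZ ZM c0.
pose ZM' := HB.pack_for {mfun T >-> R} Z (isMeasurableFun.Build _ _ _ _ Z mZ).
have iZ2 : Q.-integrable setT (EFin \o (fun x => Z x ^+ 2)).
  apply: (@bounded_integrable _ (M ^+ 2)); first exact: measurable_funX.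
  by move=> x; rewrite normrX lerXn2r ?nnegrE// (le_trans _ (ZM x)).
have : ((c ^+ 2)%:E * Q [set x | c%:E <= `|(Z x)%:E|] <=
    'E_Q[(@GRing.exp R ^~ 2%N \o Num.norm) \o Z])%E.
  apply: (@markov _ _ _ Q ZM' (@GRing.exp R ^~ 2%N)) => //.
  - by move=> r _; exact: sqr_ge0.
  - by move=> x y; rewrite !nnegrE => x0 y0; rewrite ler_sqr.
move=> H; rewrite EFinM lee_pdivlMl ?exprn_gt0//.
apply: (le_trans H); rewrite unlock.
rewrite /Rintegral fineK; last exact: integrable_fin_num.
rewrite le_eqVlt; apply/orP; left; apply/eqP; apply: eq_integral => x _ /=.
by rewrite real_normK// num_real.
Qed.

Lemma measurable_norm_ge (Z : T -> R) (c : R) :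
  measurable_fun setT Z -> measurable [set x | c <= `|Z x|].
Proof.
move=> mZ; rewrite -[X in measurable X]setTI.
apply: (measurable_fun_le measurableT (@measurable_cst _ _ _ _ _ c)).
exact: measurableT_comp.
Qed.

Lemma eventually_index_RV (E : nat -> set T) :
  (forall n, measurable (E n)) ->
  {ae Q, forall w, \forall n \near \oo, E n w} ->
  exists Nstar : {RV Q >-> nat},
    {ae Q, forall w, forall n, (Nstar w <= n)%N -> E n w}.
Proof.
move=> mE aeE.
pose G n := \bigcap_(k in [set k | (n <= k)%N]) E k.
have mG n : measurable (G n) by apply: bigcap_measurable => //; exists n => /=.
have Gle i j : (i <= j)%N -> G i `<=` G j.
  by move=> ij w Giw k /= jk; apply: Giw => /=; exact: leq_trans jk.
pose first w := xget 0%N [set n | G n w /\ forall k, G k w -> (n <= k)%N].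
have firstP w n : G n w -> G (first w) w /\ forall k, G k w -> (first w <= k)%N.
  move=> Gn; have exG : exists n, `[< G n w >] by exists n; apply/asboolP.
  case: (ex_minnP exG) => k /asboolP Gk kmin.
  rewrite /first; case: xgetP => [x _ //|/(_ k)[]].
  by split=> // j Gj; apply: kmin; apply/asboolP.
have first0 w : (forall n, ~ G n w) -> first w = 0%N.
  by move=> nG; rewrite /first; case: xgetP => // x _ [/nG].
have m1 n : measurable (first @^-1` [set n]).
  case: n => [|n].
    rewrite (_ : _ @^-1` _ = G 0%N `|` ~` (\bigcup_n G n)).
      by apply: measurableU => //; apply: measurableC; exact: bigcup_measurable.
    apply/seteqP; split=> w /=.
      move=> w0; case: (pselect (exists n, G n w)) => [[n Gn]|nG].
        by left; rewrite -w0; exact: (firstP _ _ Gn).1.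
      by right=> -[n _ Gn]; apply: nG; exists n.
    move=> [G0|nG]; first by apply/eqP; rewrite -leqn0; exact: (firstP _ _ G0).2.
    by apply: first0 => n Gn; apply: nG; exists n.
  rewrite (_ : _ @^-1` _ = G n.+1 `\` G n); first exact: measurableD.
  apply/seteqP; split=> w /=.
    move=> wn; have [k Gk] : exists k, G k w.
      by apply: contrapT => nG; move: wn; rewrite first0// => k Gk; apply: nG; exists k.
    have [Gf fmin] := firstP _ _ Gk; rewrite wn in Gf fmin; split=> //.
    by move=> /fmin; rewrite ltnn.
  move=> [Gn1 nGn]; have [Gf fmin] := firstP _ _ Gn1.
  apply/eqP; rewrite eqn_leq fmin//= ltnNge; apply/negP => fn.
  by apply: nGn; exact: Gle Gf.
have mfirst : measurable_fun setT first.
  move=> _ Y _; rewrite setTI (_ : _ @^-1` _ = \bigcup_(n in Y) (first @^-1` [set n])).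
    exact: bigcup_measurable.
  apply/seteqP; split=> w; first by move=> Yw; exists (first w).
  by move=> [n Yn fn]; rewrite /preimage/= (fn : first w = n).
exists (HB.pack_for {mfun T >-> nat} first
  (isMeasurableFun.Build _ _ _ _ first mfirst)).
move: aeE; apply: filterS => w [n _ En] k /= fk.
have Gn : G n w by move=> j /= nj; exact: En.
by apply: (firstP _ _ Gn).1.
Qed.

End probability_integrals.

(** * Pairwise independent, identically distributed variables *)

Section iid.
Context {d d'} {Omega : measurableType d} {T : measurableType d'} {R : realType}.
Context (P : probability Omega R) (mu : probability T R).
Variable X : nat -> {RV P >-> T}.
Hypothesis X_distr : forall n A, measurable A -> distribution P (X n) A = mu A.
Hypothesis X_indep : forall i j A B, i != j -> measurable A -> measurable B ->
  P (X i @^-1` A `&` X j @^-1` B) = (mu A * mu B)%E.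

Lemma ge0_integral_iid (f : T -> \bar R) n :
  measurable_fun [set: T] f -> (forall x, 0 <= f x)%E ->
  (\int[P]_w f (X n w) = \int[mu]_x f x)%E.
Proof.
move=> mf f0; rewrite -(@ge0_integral_distribution _ _ _ _ _ P (X n))//.
by apply: eq_measure_integral => A mA _; exact: X_distr.
Qed.

(** The joint law of [(X i, X j)] agrees with [mu \x mu] on rectangles, hence everywhere, and
    Tonelli splits the integral. *)
Lemma ge0_integralM_iid (f g : T -> R) i j : i != j ->
  measurable_fun setT f -> (forall x, 0 <= f x) ->
  measurable_fun setT g -> (forall x, 0 <= g x) ->
  (\int[P]_w (f (X i w) * g (X j w))%:E =
   (\int[mu]_x (f x)%:E) * \int[mu]_x (g x)%:E)%E.
Proof.
move=> ij mf f0 mg g0.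
pose h (w : Omega) : T * T := (X i w, X j w).
have mh : measurable_fun setT h by exact: measurable_fun_pair.
pose hM := HB.pack_for {mfun Omega >-> (T * T)%type} h
  (isMeasurableFun.Build _ _ _ _ h mh).
have prodE : forall A, measurable A -> A `<=` setT ->
    (mu \x mu)%E A = distribution P hM A.
  move=> A mA _; apply: product_measure_unique => // B C mB mC.
  by rewrite -(X_indep ij mB mC).
pose fg (z : T * T) := (f z.1 * g z.2)%:E.
have mfg : measurable_fun setT fg.
  apply/measurable_EFinP; apply: measurable_funM.
    exact: measurableT_comp mf measurable_fst.
  exact: measurableT_comp mg measurable_snd.
have fg0 z : (0 <= fg z)%E by rewrite lee_fin mulr_ge0.
transitivity (\int[distribution P hM]_z fg z)%E.
  by rewrite ge0_integral_distribution.
rewrite -(eq_measure_integral _ prodE) fubini_tonelli1//.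
rewrite /fubini_F/= /fg/=.
have mf' : measurable_fun setT (EFin \o f) by exact/measurable_EFinP.
have mg' : measurable_fun setT (EFin \o g) by exact/measurable_EFinP.
transitivity (\int[mu]_x ((f x)%:E * \int[mu]_y (g y)%:E))%E.
  apply: eq_integral => x _; under eq_integral do rewrite EFinM.
  by rewrite ge0_integralZl ?lee_fin// => y _; rewrite lee_fin.
rewrite ge0_integralZr//.
- by move=> y _; rewrite lee_fin.
- by apply: integral_ge0 => y _; rewrite lee_fin.
Qed.

Lemma Rintegral_iid (f : T -> R) n :
  measurable_fun setT f -> (forall x, 0 <= f x) ->
  (\int[P]_w f (X n w) = \int[mu]_x f x).
Proof.
move=> mf f0; rewrite /Rintegral (@ge0_integral_iid (EFin \o f))//.
exact/measurable_EFinP.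
Qed.

(** A variance computation: the off-diagonal terms vanish by pairwise independence, and each
    diagonal term is the second moment minus [m ^+ 2]. Products of the centred [W i] are first
    expanded into products of [g], since the product rule above is for nonnegative functions. *)
Lemma second_moment_sum_iid (g : T -> R) (M : R) k :
  measurable_fun setT g -> (forall x, 0 <= g x <= M) ->
  \int[P]_w (\sum_(i < k) g (X i w) - k%:R * \int[mu]_x g x) ^+ 2
    <= k%:R * \int[mu]_x (g x ^+ 2).
Proof.
move=> mg gM; set m := \int[mu]_x g x.
have g0 x : 0 <= g x by have /andP[] := gM x.
have gleM x : g x <= M by have /andP[] := gM x.
have m0 : 0 <= m by exact: Rintegral_ge0.
have mgX i : measurable_fun setT (fun w => g (X i w)) by exact: measurableT_comp.
pose W i w := g (X i w) - m.
have mW i : measurable_fun setT (W i) by exact: measurable_funB.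
have bW i w : `|W i w| <= M + m.
  by rewrite (le_trans (ler_normB _ _))// lerD ?ger0_norm.
have iWW i j : P.-integrable setT (EFin \o (fun w => W i w * W j w)).
  apply: (@bounded_integrable _ _ _ _ _ ((M + m) * (M + m))).
    exact: measurable_funM.
  by move=> w; rewrite normrM ler_pM.
have igg i j : P.-integrable setT (EFin \o (fun w => g (X i w) * g (X j w))).
  apply: (@bounded_integrable _ _ _ _ _ (M * M)).
    exact: measurable_funM.
  by move=> w; rewrite normrM ler_pM ?ger0_norm.
have ig i : P.-integrable setT (EFin \o (fun w => g (X i w))).
  by apply: (@bounded_integrable _ _ _ _ _ M) => // w; rewrite ger0_norm.
have Eg i : \int[P]_w g (X i w) = m by exact: Rintegral_iid.
have EWW i j : \int[P]_w (W i w * W j w) =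
    \int[P]_w (g (X i w) * g (X j w)) - m ^+ 2.
  transitivity (\int[P]_w (g (X i w) * g (X j w)
      - (m * g (X i w) + (m * g (X j w) - m ^+ 2)))).
    by apply: eq_Rintegral => w _; rewrite /W; ring.
  have iZ l : P.-integrable setT (EFin \o (fun w => m * g (X l w))).
    exact: integrableZl (ig l).
  have ic (c : R) : P.-integrable setT (EFin \o (fun _ => c)).
    by apply: (@bounded_integrable _ _ _ _ _ `|c|).
  have iB l : P.-integrable setT (EFin \o (fun w => m * g (X l w) - m ^+ 2)).
    exact: integrableB (iZ l) (ic _).
  have iD : P.-integrable setT
      (EFin \o (fun w => m * g (X i w) + (m * g (X j w) - m ^+ 2))).
    exact: integrableD (iZ i) (iB j).
  rewrite RintegralB//.
  rewrite RintegralD// RintegralB// !RintegralZl// !Eg.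
  by rewrite Rintegral_probability_cst; ring.
have sqE w : (\sum_(i < k) g (X i w) - k%:R * m) ^+ 2 =
    \sum_(i < k) \sum_(j < k) W i w * W j w.
  rewrite (_ : _ - _ = \sum_(i < k) W i w); last first.
    by rewrite /W sumrB sumr_const card_ord mulr_natl.
  by rewrite expr2 mulr_suml; apply: eq_bigr => i _; rewrite mulr_sumr.
have iS i : P.-integrable setT (EFin \o (fun w => \sum_(j < k) W i w * W j w)).
  exact: integrable_EFin_sum.
under eq_Rintegral do rewrite sqE.
rewrite Rintegral_sum//.
rewrite -[X in X%:R * _]card_ord mulr_natl -sumr_const.
apply: ler_sum => i _; rewrite Rintegral_sum// (bigD1 i)//= big1 ?addr0.
  rewrite EWW. under eq_Rintegral do rewrite -expr2.
  rewrite (@Rintegral_iid (fun x => g x ^+ 2)) ?gerBl ?sqr_ge0//.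
    exact: measurable_funX.
  by move=> x; exact: sqr_ge0.
move=> j ji; rewrite EWW [X in X - _](_ : _ = m * m) ?expr2 ?subrr//.
rewrite {1}/Rintegral ge0_integralM_iid//; last by rewrite eq_sym.
rewrite fineM//.
- apply: integrable_fin_num => //.
  by apply: (@bounded_integrable _ _ _ _ _ M) => // w; rewrite ger0_norm.
- apply: integrable_fin_num => //.
  by apply: (@bounded_integrable _ _ _ _ _ M) => // w; rewrite ger0_norm.
Qed.

(* Etemadi's argument along the geometric subsequence of sizes [b^n], with all
   the variables of the [n]-th sample truncated at the same level [b^n]. *)
Section truncation.
Variable h : T -> R.
Hypotheses (mh : measurable_fun setT h) (h0 : forall x, 0 <= h x).
Hypothesis ih : mu.-integrable setT (EFin \o h).

Let trunc (a : R) (x : T) : R := Num.min (h x) a.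

Let mtrunc a : measurable_fun setT (trunc a).
Proof. by apply: measurable_minr => //; exact: measurable_cst. Qed.

Let trunc_itv a x : 0 < a -> 0 <= trunc a x <= a.
Proof. by move=> a0; rewrite le_min h0 ltW//= ge_min lexx orbT. Qed.

Let norm_trunc a x : 0 < a -> `|trunc a x| <= a.
Proof. by move=> /(trunc_itv x)/andP[t0 ta]; rewrite ger0_norm. Qed.

(** Either some variable reaches the level [a], or the sum equals the truncated sum, which then
    deviates by [k * e]. Let [v] be the truncated second moment. The first event costs
    [k * v / a^2 <= v / a], as [k <= a]; the second costs [v / (k * e^2) <= (2 / e^2) * (v / a)], as
    [a <= 2 * k]. Both are thus controlled by [v / a], which is summable over [a = b^n]. *)
Lemma mean_deviation_trunc (a e : R) (k : nat) : 0 < a -> 0 < e ->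
  (0 < k)%N -> k%:R <= a -> a <= 2 * k%:R ->
  (P [set w | (e <= `|(\sum_(i < k) h (X i w)) / k%:R
                     - \int[mu]_x Num.min (h x) a|)%R] <=
   ((1 + 2 / e ^+ 2) * \int[mu]_x (Num.min (h x) a ^+ 2 / a))%:E)%E.
Proof.
move=> a0 e0 k0 ka ak; set m := \int[mu]_x Num.min (h x) a.
have kR0 : 0 < k%:R :> R by rewrite ltr0n.
have mX i : measurable_fun setT (fun w => trunc a (X i w)).
  exact: measurableT_comp.
have mhX i : measurable_fun setT (fun w => h (X i w)) by exact: measurableT_comp.
have i2 : mu.-integrable setT (EFin \o (fun x => trunc a x ^+ 2)).
  apply: (@bounded_integrable _ _ _ _ _ (a ^+ 2)); first exact: measurable_funX.
  by move=> x; rewrite normrX lerXn2r ?nnegrE ?(ltW a0)// norm_trunc.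
pose v := \int[mu]_x (trunc a x ^+ 2).
have v0 : 0 <= v by apply: Rintegral_ge0 => x _; exact: sqr_ge0.
have -> : \int[mu]_x (Num.min (h x) a ^+ 2 / a) = v / a by rewrite RintegralZr.
pose A i := [set w | a <= `|trunc a (X i w)|].
have mA i : measurable (A i).
  exact: measurable_norm_ge.
pose S w := \sum_(i < k) trunc a (X i w) - k%:R * m.
have mS : measurable_fun setT S.
  by apply: measurable_funB => //; exact: measurable_sum.
pose B := [set w | k%:R * e <= `|S w|].
have mB : measurable B.
  exact: measurable_norm_ge.
have PA i : (P (A i) <= (a ^- 2 * v)%:E)%E.
  have := @chebyshev_sqr _ _ _ P (fun w => trunc a (X i w)) a a (mX i)
    (fun w => norm_trunc (X i w) a0) a0.
  rewrite (@Rintegral_iid (fun x => trunc a x ^+ 2))//.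
    exact: measurable_funX.
  by move=> x; exact: sqr_ge0.
have bS w : `|S w| <= k%:R * a + k%:R * m.
  have m0 : 0 <= m by apply: Rintegral_ge0 => x _; have /andP[] := trunc_itv x a0.
  rewrite (le_trans (ler_normB _ _))// lerD//; last first.
    by rewrite ger0_norm// mulr_ge0// ltW.
  rewrite (le_trans (ler_norm_sum _ _ _))//.
  rewrite -[X in X%:R * _]card_ord mulr_natl -sumr_const.
  by apply: ler_sum => i _; exact: norm_trunc.
have PB : (P B <= ((k%:R * e) ^- 2 * (k%:R * v))%:E)%E.
  apply: (le_trans (chebyshev_sqr P mS bS _)); first by rewrite mulr_gt0.
  rewrite lee_fin ler_wpM2l ?invr_ge0 ?sqr_ge0//.
  by apply: (@second_moment_sum_iid _ a) => // x; exact: trunc_itv.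
have mE : measurable [set w | e <= `|(\sum_(i < k) h (X i w)) / k%:R - m|].
  apply: measurable_norm_ge; apply: measurable_funB => //.
  by apply: measurable_funM => //; exact: measurable_sum.
apply: (@le_trans _ _ (P (\big[setU/set0]_(i < k) A i `|` B))).
  rewrite le_measure ?inE//.
    by apply: measurableU => //; exact: bigsetU_measurable.
  move=> w /= ew; apply: contrapT => /not_orP[nA nB]; apply: nB.
  have SE : \sum_(i < k) trunc a (X i w) = \sum_(i < k) h (X i w).
    apply: eq_bigr => i _; rewrite /trunc minEle; case: ifPn => //.
    rewrite -ltNge => ah; exfalso; apply: nA.
    rewrite -bigcup_mkord; exists i => //=; rewrite /A/=.
    by rewrite /trunc (min_idPr (ltW ah)) ger0_norm// ltW.
  rewrite /B/= /S SE -ler_pdivlMl// -[X in X * `|_|]ger0_norm ?invr_ge0 ?(ltW kR0)//.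
  by rewrite -normrM mulrBr mulKf ?gt_eqF// [_^-1 * _]mulrC.
apply: (le_trans (measureU2 _ _ _)) => //.
  exact: bigsetU_measurable.
rewrite mulrDl mul1r EFinD leeD//.
  apply: (le_trans (@Boole_inequality _ _ _ P _ _ _)) => //.
  apply: (@le_trans _ _ (\sum_(i < k) (a ^- 2 * v)%:E)%E).
    by apply: lee_sum => i _; exact: PA.
  rewrite sumEFin lee_fin sumr_const card_ord -mulr_natl.
  rewrite (_ : v / a = a * (a ^- 2 * v)); last by field; rewrite gt_eqF.
  by rewrite ler_wpM2r// mulr_ge0// invr_ge0 sqr_ge0.
apply: (le_trans PB); rewrite lee_fin.
rewrite (_ : _ * (k%:R * v) = v / e ^+ 2 * k%:R^-1); last first.
  by field; rewrite !gt_eqF.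
rewrite (_ : 2 / _ * _ = v / e ^+ 2 * (2 / a)); last first.
  by field; rewrite !gt_eqF.
rewrite ler_wpM2l ?divr_ge0 ?sqr_ge0//.
by rewrite ler_pdivlMr// ler_pdivrMl// mulrC.
Qed.

Lemma sum_trunc_second_moment (b : R) (N : nat) : 1 < b ->
  \sum_(0 <= n < N) \int[mu]_x (Num.min (h x) (b ^+ n) ^+ 2 / b ^+ n)
    <= b ^+ 2 / (b - 1) * 2 * \int[mu]_x h x.
Proof.
move=> b1; have b0 : 0 < b by exact: lt_trans b1.
have iv n : mu.-integrable setT
    (EFin \o (fun x => Num.min (h x) (b ^+ n) ^+ 2 / b ^+ n)).
  have bn0 : 0 < b ^+ n by rewrite exprn_gt0.
  apply: (@bounded_integrable _ _ _ _ _ ((b ^+ n) ^+ 2 / b ^+ n)).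
    by apply: measurable_funM => //; apply: measurable_funX; exact: mtrunc.
  move=> x; rewrite normrM ler_pM// ?[`|_^-1|]ger0_norm ?invr_ge0 ?(ltW bn0)//.
  by rewrite normrX lerXn2r ?nnegrE ?(ltW bn0)// norm_trunc.
rewrite -Rintegral_sum// -RintegralZl//; apply: le_Rintegral => //.
- exact: integrable_EFin_sum.
- exact: (integrableZl measurableT _ ih).
- by move=> x _; exact: sum_minr_sqr_div_le.
Qed.

Lemma cvg_trunc_mean (b : R) : 1 < b ->
  \int[mu]_x Num.min (h x) (b ^+ n) @[n --> \oo] --> \int[mu]_x h x.
Proof.
move=> b1; have b0 : 0 < b by exact: lt_trans b1.
have i0 n : mu.-integrable setT (EFin \o trunc (b ^+ n)).
  apply: (@bounded_integrable _ _ _ _ _ (b ^+ n)) => // x.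
  by rewrite norm_trunc// exprn_gt0.
apply: fine_cvg; rewrite fineK; last exact: integrable_fin_num.
apply: (@dominated_cvg _ _ _ _ _ _ _ _ (EFin \o h)) => //.
- by move=> n; apply/measurable_EFinP; exact: mtrunc.
- move=> x _ /=; apply: cvg_EFin; first by near=> n.
  apply: cvg_near_cst; near=> n.
  apply/min_idPl.
  by near: n; exact: near_le_expr.
- move=> n x _ /=; have /andP[t0 _] := trunc_itv x (exprn_gt0 n b0).
  by rewrite lee_fin ger0_norm// ge_min lexx.
Unshelve. all: by end_near. Qed.

Let k (b : R) n := Num.truncn (b ^+ n).

Let k_bounds b n : 1 < b -> [/\ (0 < k b n)%N, (k b n)%:R <= b ^+ n,
  b ^+ n <= 2 * (k b n)%:R & b ^+ n < (k b n)%:R + 1].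
Proof.
move=> b1; have bn1 : 1 <= b ^+ n by rewrite exprn_ege1// ltW.
have bn0 : 0 <= b ^+ n by exact: le_trans bn1.
have k0 : (0 < k b n)%N by rewrite truncn_gt0.
have := truncn_itv bn0; rewrite -/(k b n) => /andP[kb bk].
rewrite -natr1 in bk; split => //.
by rewrite (le_trans (ltW bk))// mulr_natl mulr2n lerD2l ler1n.
Qed.

(** Borel-Cantelli: the deviation probabilities along [b^n] have a sum bounded by a multiple of the
    integral of [h]. *)
Lemma geometric_deviation_ae (b e : R) : 1 < b -> 0 < e ->
  {ae P, forall w, \forall n \near \oo,
    `|(\sum_(i < k b n) h (X i w)) / (k b n)%:R
      - \int[mu]_x Num.min (h x) (b ^+ n)| < e}.
Proof.
move=> b1 e0; have b0 : 0 < b by exact: lt_trans b1.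
pose F n := [set w | e <= `|(\sum_(i < k b n) h (X i w)) / (k b n)%:R
      - \int[mu]_x Num.min (h x) (b ^+ n)|].
have mF n : measurable (F n).
  apply: measurable_norm_ge; apply: measurable_funB => //.
  apply: measurable_funM => //; apply: measurable_sum => i.
  exact: measurableT_comp.
have F0 : P (lim_sup_set F) = 0%E.
  apply: lim_sup_set_cvg0 => //.
  apply: (@le_lt_trans _ _
    ((1 + 2 / e ^+ 2) * (b ^+ 2 / (b - 1) * 2 * \int[mu]_x h x))%:E); last first.
    by rewrite ltry.
  apply: lime_le; first by apply: is_cvg_nneseries.
  apply: nearW => N.
  apply: (@le_trans _ _ (\sum_(0 <= n < N) ((1 + 2 / e ^+ 2) *
      \int[mu]_x (Num.min (h x) (b ^+ n) ^+ 2 / b ^+ n))%:E)%E).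
    apply: lee_sum => n _; have [k0 kb bk _] := k_bounds n b1.
    by apply: mean_deviation_trunc => //; rewrite exprn_gt0.
  rewrite sumEFin lee_fin -mulr_sumr ler_wpM2l//.
    by rewrite addr_ge0// divr_ge0// sqr_ge0.
  exact: sum_trunc_second_moment.
exists (lim_sup_set F); split => //.
  by apply: bigcapT_measurable => n; exact: bigcup_measurable.
move=> w /= nw n _; apply: contrapT => nF; apply: nw.
exists n => //= j /= nj; rewrite ltNge; apply/negP => ej; apply: nF.
by exists j.
Qed.

Lemma geometric_lln (b : R) : 1 < b ->
  {ae P, forall w, (\sum_(i < k b n) h (X i w)) / (k b n)%:R @[n --> \oo]
    --> \int[mu]_x h x}.
Proof.
move=> b1.
have : {ae P, forall w, forall j, \forall n \near \oo,
    `|(\sum_(i < k b n) h (X i w)) / (k b n)%:R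
      - \int[mu]_x Num.min (h x) (b ^+ n)| < j.+1%:R^-1}.
  apply: ae_foralln => j; apply: geometric_deviation_ae => //.
apply: filterS => w Hw.
rewrite (_ : (fun n => _) = (fun n => ((\sum_(i < k b n) h (X i w)) / (k b n)%:R
      - \int[mu]_x Num.min (h x) (b ^+ n)) + \int[mu]_x Num.min (h x) (b ^+ n))); last first.
  by apply/funext => n; rewrite subrK.
rewrite -[X in _ --> X]add0r; apply: cvgD; last exact: cvg_trunc_mean.
apply/cvgr0Pnorm_lt => e e0.
have [j je] : exists j : nat, j.+1%:R^-1 < e.
  exists (Num.truncn e^-1); rewrite invf_plt ?posrE ?ltr0n//.
  exact: truncnS_gt.
by apply: filterS (Hw j) => n /lt_trans; apply.
Qed.

(* For a nondecreasing [S], the value [S N / N] with [b^n <= N < b^(n+1)] is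
   within a factor [b^2] of the values at sizes [b^n] and [b^(n+1)]. *)
Lemma cvg_average_of_geometric (S : nat -> R) (m : R) :
  {homo S : i j / (i <= j)%N >-> i <= j} -> (forall i, 0 <= S i) -> 0 <= m ->
  (forall j, S (k (1 + j.+1%:R^-1) n) / (k (1 + j.+1%:R^-1) n)%:R
     @[n --> \oo] --> m) ->
  S N / N%:R @[N --> \oo] --> m.
Proof.
move=> Snd S0 m0 Sm; apply/cvgrPdist_le => e e0.
(* Chosen so that [b^2 <= 1 + 3 * t] and [3 * t * (m + e) <= e / 2]: multiplication by [b^2] then
   uses up at most the half of [e] left by the bounds on [q]. *)
have e60 : 0 < e / (6 * (m + e)) by rewrite divr_gt0// mulr_gt0// ltr_wpDl.
have [j je] : exists j : nat, j.+1%:R^-1 < e / (6 * (m + e)).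
  exists (Num.truncn (e / (6 * (m + e)))^-1).
  by rewrite invf_plt ?posrE ?ltr0n//; exact: truncnS_gt.
move: (Sm j); set t : R := j.+1%:R^-1 in je *; set b := 1 + t.
have t0 : 0 < t by rewrite invr_gt0 ltr0n.
have t1 : t <= 1 by rewrite invf_le1 ?ler1n ?ltr0n.
have b1 : 1 < b by rewrite ltrDl.
have b0 : 0 < b by exact: lt_trans b1.
have te : t * (6 * (m + e)) <= e.
  by rewrite -ler_pdivlMr ?(ltW je)// mulr_gt0// ltr_wpDl.
have b2 : b ^+ 2 <= 1 + 3 * t by rewrite /b; nra.
have e2 : 0 < e / 2 by rewrite divr_gt0.
move=> /cvgrPdist_lt/(_ _ e2)[n1 _ Hq].
(* Beyond [n2] the integer part satisfies [k b n >= t^-1], so [b^n < k b n + 1 <= b * k b n]: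
   rounding down costs one more factor [b]. *)
have [n2 _ Hn2] := near_le_expr (t^-1 + 1) b1.
pose n0 := maxn n1 n2.
have [N0 _ HN0] : \forall N \near \oo, b ^+ n0 <= N%:R by exact: nbhs_infty_ger.
exists N0 => // N NN0.
have Nb : b ^+ n0 <= N%:R by exact: HN0.
have NR0 : 0 < N%:R :> R by apply: lt_le_trans Nb; rewrite exprn_gt0.
have [n [n0n bnN Nbn]] : exists n, [/\ (n0 <= n)%N, b ^+ n <= N%:R & N%:R < b ^+ n.+1].
  have [n3 _ Hn3] := near_le_expr (N%:R + 1) b1.
  have exn : exists n, N%:R < b ^+ n.+1.
    exists n3; apply: lt_le_trans (Hn3 n3.+1 _); first by rewrite ltrDl.
    exact: leqnSn.
  case: (ex_minnP exn) => n nN nmin; exists n; split => //.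
    by rewrite -ltnS -(ltr_eXn2l b1) ?(le_lt_trans Nb)//.
  case: n nN nmin => [|n] _ nmin.
    by rewrite expr0 ler1n -(ltr0n R).
  by rewrite leNgt; apply/negP => /nmin; rewrite ltnn.
have [k0 kb _ bk] := k_bounds n b1.
have [k0' kb' _ bk'] := k_bounds n.+1 b1.
pose q i := S (k b i) / (k b i)%:R.
have qb i : (n0 <= i)%N -> m - e / 2 <= q i <= m + e / 2.
  move=> n0i; have := Hq i (leq_trans (leq_maxl _ _) n0i).
  by rewrite -/(q i) distrC => /ltW; rewrite ler_distl.
have /andP[qn _] := qb n n0n.
have /andP[_ qn'] := qb n.+1 (leqW n0n).
have q0 i : 0 <= q i by rewrite divr_ge0.
have upper : S N / N%:R <= b ^+ 2 * q n.+1.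
  have Nk : (N <= k b n.+1)%N.
    by rewrite truncn_ge_nat ?(ltW Nbn)// ltW// exprn_gt0.
  rewrite ler_pdivrMr// (le_trans (Snd _ _ Nk))// /q.
  have kR0 : (k b n.+1)%:R != 0 :> R by rewrite gt_eqF// ltr0n.
  rewrite -[leLHS](divfK kR0) [leRHS]mulrAC [leRHS]mulrC.
  rewrite ler_wpM2l ?q0// (le_trans kb')//.
  rewrite exprS expr2 -mulrA ler_wpM2l ?(ltW b0)// (le_trans bnN)//.
  by rewrite ler_peMl ?(ltW b1)// ltW.
have lower : q n <= b ^+ 2 * (S N / N%:R).
  have kN : (k b n <= N)%N by rewrite -(ler_nat R) (le_trans kb).
  have kt : t^-1 <= (k b n)%:R.
    have := Hn2 n (leq_trans (leq_maxr _ _) n0n) => /= H.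
    by rewrite -(lerD2r 1) (le_trans H)// ltW.
  have Nk : N%:R <= b ^+ 2 * (k b n)%:R.
    rewrite (le_trans (ltW Nbn))// exprS expr2 -mulrA ler_wpM2l ?(ltW b0)//.
    rewrite (le_trans (ltW bk))// mulrDl mul1r lerD2l.
    by rewrite mulrC -ler_pdivrMr// mul1r.
  rewrite mulrA ler_pdivlMr// /q mulrAC ler_pdivrMr ?ltr0n//.
  by rewrite [leRHS]mulrAC [leRHS]mulrC ler_pM// Snd.
rewrite ler_distlC; apply/andP; split.
  case: (leP (m - e) 0) => me.
    by rewrite (le_trans me)// divr_ge0// ltW.
  have : b ^+ 2 * (m - e) <= b ^+ 2 * (S N / N%:R) by nra.
  by rewrite ler_pM2l// exprn_gt0.
nra.
Qed.

(** The ratios [1 + 1 / (j + 1)] come arbitrarily close to [1] and are countably many, so one null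
    set serves for all of them. *)
Lemma lln_ge0 :
  {ae P, forall w, (\sum_(i < N) h (X i w)) / N%:R @[N --> \oo]
    --> \int[mu]_x h x}.
Proof.
have : {ae P, forall w, forall j,
    (\sum_(i < k (1 + j.+1%:R^-1) n) h (X i w)) / (k (1 + j.+1%:R^-1) n)%:R
       @[n --> \oo] --> \int[mu]_x h x}.
  apply: ae_foralln => j; apply: geometric_lln.
  by rewrite ltrDl invr_gt0 ltr0n.
apply: filterS => w Hw.
apply: (@cvg_average_of_geometric (fun N => \sum_(i < N) h (X i w))) => //.
- move=> i j ij; rewrite -!(big_mkord xpredT (fun i => h (X i w))).
  by rewrite (big_cat_nat _ ij)//= lerDl sumr_ge0.
- by move=> i; exact: sumr_ge0.
- by apply: Rintegral_ge0 => x _.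
Qed.
End truncation.
End iid.

(** * Angles and the clipped cosine *)

Section angles.
Context {R : realType} (alpha : R).
Hypothesis halpha : 2 * pi < alpha.

Let alpha_gt0 : 0 < alpha.
Proof. by apply: lt_trans halpha; rewrite mulr_gt0 ?pi_gt0. Qed.

Local Notation ang := (angle_of alpha).

Lemma angle_of_surj (t : angle alpha) : exists x, ang x = t.
Proof. by exists (repr t); exact: reprK. Qed.

Lemma angle_of_eqP x y : ang x = ang y <-> exists n : int, y = n%:~R * alpha + x.
Proof.
split=> [/eqmodP/asboolP//|xy].
by apply/eqmodP/asboolP.
Qed.

Lemma angle_ofDz x (n : int) : ang (n%:~R * alpha + x) = ang x.
Proof. by apply/esym/angle_of_eqP; exists n. Qed.

Lemma adiffsP x y z :
  adiffs (ang x) (ang y) z <-> exists n : int, z = n%:~R * alpha + (x - y).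
Proof.
split=> [[a [b [ax by_ ->]]]|[n ->]].
  have /angle_of_eqP[n ->] := esym ax; have /angle_of_eqP[m ->] := esym by_.
  by exists (n - m); rewrite rmorphB/=; ring.
exists (n%:~R * alpha + x), y; split=> //; first exact: angle_ofDz.
by rewrite addrA.
Qed.

Lemma adist_le x y : adist (ang x) (ang y) <= `|x - y|.
Proof.
apply: ge_inf; first by exists 0 => _ [z _ <-].
exists (x - y) => //; apply/adiffsP; exists 0.
by rewrite mul0r add0r.
Qed.

Lemma adist_geP x y c :
  (forall n : int, c <= `|n%:~R * alpha + (x - y)|) -> c <= adist (ang x) (ang y).
Proof.
move=> H; apply: lb_le_inf.
  by exists `|x - y|, (x - y) => //; apply/adiffsP; exists 0; rewrite mul0r add0r.
by move=> _ [z /adiffsP[n ->] <-].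
Qed.

Lemma normr_multiple_ge (n : int) d : n != 0 -> alpha - `|d| <= `|n%:~R * alpha + d|.
Proof.
move=> n0; have H : alpha <= `|n%:~R * alpha|.
  rewrite normrM (ger0_norm (ltW alpha_gt0)) ler_peMl ?(ltW alpha_gt0)//.
  by rewrite norm_intr_ge1 ?intr_eq0 ?intr_int.
have := ler_normB (n%:~R * alpha + d) d; rewrite addrK; lra.
Qed.

Lemma adist_ge x y : Num.min `|x - y| (alpha - `|x - y|) <= adist (ang x) (ang y).
Proof.
apply: adist_geP => n; have [->|n0] := eqVneq n 0.
  by rewrite mul0r add0r ge_min lexx.
by rewrite ge_min normr_multiple_ge ?orbT.
Qed.

Lemma adist_eq x y : `|x - y| <= alpha / 2 -> adist (ang x) (ang y) = `|x - y|.
Proof.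
move=> xy; apply/eqP; rewrite eq_le adist_le/=.
by apply: le_trans (adist_ge _ _); rewrite le_min lexx/=; lra.
Qed.

(** Rounding to the nearest multiple of [alpha] gives the representative closest to [y]. This is the
    means by which statements on the circle become statements on the real line. *)
Lemma adist_rep (t : angle alpha) y : exists x,
  [/\ ang x = t, `|x - y| = adist t (ang y) & `|x - y| <= alpha / 2].
Proof.
have [z zt] := angle_of_surj t.
pose u := (y - z) / alpha.
have uE : u * alpha = y - z by rewrite divfK// gt_eqF.
pose n := Num.floor (u + 2^-1); exists (n%:~R * alpha + z).
have nz : `|n%:~R * alpha + z - y| <= alpha / 2.
  have /andP[n1 n2] := floor_itv (u + 2^-1); rewrite -/n in n1 n2.
  have := ler_wpM2r (ltW alpha_gt0) n1.
  have := ltW n2 => /(ler_wpM2r (ltW alpha_gt0)).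
  rewrite intrD !mulrDl uE => H1 H2.
  by rewrite ler_norml; apply/andP; split; lra.
have ->  : t = ang (n%:~R * alpha + z) by rewrite angle_ofDz.
by rewrite adist_eq.
Qed.

Lemma adist_ge0 (t t' : angle alpha) : 0 <= adist t t'.
Proof.
by have [x <-] := angle_of_surj t'; have [y [<- <- _]] := adist_rep t x.
Qed.

Lemma adistC (t t' : angle alpha) : adist t t' = adist t' t.
Proof.
have [x <-] := angle_of_surj t'; have [y [<- <- xy]] := adist_rep t x.
by rewrite adist_eq distrC.
Qed.

Lemma adist_triangle (t1 t2 t3 : angle alpha) :
  adist t1 t3 <= adist t1 t2 + adist t2 t3.
Proof.
have [x <-] := angle_of_surj t2.
have [y [<- <- _]] := adist_rep t1 x; have [z [<- zx _]] := adist_rep t3 x.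
rewrite [adist (ang x) _]adistC -zx [`|z - x|]distrC.
exact: le_trans (adist_le _ _) (ler_distD _ _ _).
Qed.

Lemma adist_eq0 (t t' : angle alpha) : adist t t' = 0 -> t = t'.
Proof.
have [x <-] := angle_of_surj t'; have [y [<- <- _]] := adist_rep t x.
by move=> /normr0P; rewrite subr_eq0 => /eqP->.
Qed.

Lemma angle_net (e : R) : 0 < e -> exists M : nat, exists x : nat -> R,
  forall t : angle alpha, exists2 k, (k < M)%N & adist t (ang (x k)) <= e.
Proof.
move=> e0; pose M := (Num.truncn (alpha / e)).+1.
exists M, (fun k => k%:R * e) => t.
have [x [<- _ xa]] := adist_rep t (alpha / 2).
move: xa; rewrite ler_norml => /andP[xl xr].
have x0 : 0 <= x by lra.
have xe0 : 0 <= x / e by rewrite divr_ge0// ltW.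
exists (Num.truncn (x / e)).
  by rewrite ltnS le_truncn// ler_pM2r ?invr_gt0//; lra.
apply: (le_trans (adist_le _ _)).
have /andP[k1 k2] := truncn_itv xe0.
rewrite ler_pdivlMr// in k1; rewrite ltr_pdivrMr// -natr1 mulrDl mul1r in k2.
by rewrite ger0_norm; lra.
Qed.

(** Clipping the distance at pi merges the two cases of [fold] and makes the expression symmetric in
    the two angles. *)
Definition clipped_cos (t' t : angle alpha) : R := cos (Num.min (adist t' t) pi).

Let clip (t' t : angle alpha) : R := Num.min (adist t' t) pi.

Let clip_itv t' t : 0 <= clip t' t <= pi.
Proof. by rewrite le_min adist_ge0 pi_ge0 ge_min lexx orbT. Qed.

Let clip_lip (t1 t2 t : angle alpha) : `|clip t1 t - clip t2 t| <= clip t1 t2.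
Proof.
have /andP[c1 c1'] := clip_itv t1 t; have /andP[c2 c2'] := clip_itv t2 t.
rewrite [leRHS]/clip le_min; apply/andP; split; last first.
  by rewrite ler_norml; apply/andP; split; lra.
have h1 := adist_triangle t1 t2 t; have h2 := adist_triangle t2 t1 t.
rewrite (adistC t2 t1) in h2; have h0 := adist_ge0 t1 t2.
by rewrite /clip !minEle ler_norml; apply/andP; split;
  case: (leP (adist t1 t)); case: (leP (adist t2 t)); lra.
Qed.

Lemma clipped_cosC t' t : clipped_cos t' t = clipped_cos t t'.
Proof. by rewrite /clipped_cos adistC. Qed.

Lemma clipped_cos_le1 t' t : `|clipped_cos t' t| <= 1.
Proof. by rewrite ler_norml cos_geN1 cos_le1. Qed.

Lemma clipped_cos_lip (t t1 t2 : angle alpha) :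
  `|clipped_cos t t1 - clipped_cos t t2| <= adist t1 t2.
Proof.
rewrite ![clipped_cos t _]clipped_cosC (le_trans (dist_cos_le _ _))//.
by rewrite (le_trans (clip_lip _ _ _))// ge_min lexx.
Qed.

(** The right-hand side bounds a squared chord of the unit circle: adding the squared difference of
    the sines on the left gives [2 * (1 - cos (x1 - x2))] for the clipped distances [x1], [x2] to
    [t], and [x1 - x2] is at most the clipped distance of [t1] and [t2]. *)
Lemma sqr_clipped_cosB_le (t t1 t2 : angle alpha) :
  (clipped_cos t1 t - clipped_cos t2 t) ^+ 2 <= 2 * (1 - clipped_cos t1 t2).
Proof.
have /andP[h0 hpi] := clip_itv t1 t2.
have H : clipped_cos t1 t2 <= cos (clip t1 t - clip t2 t).
  rewrite -[leRHS]cos_norm; apply: cos_le_homo => //; exact: clip_lip.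
rewrite cosB in H.
rewrite [clipped_cos t1 t]/clipped_cos [clipped_cos t2 t]/clipped_cos.
rewrite -/(clip t1 t) -/(clip t2 t).
have := cos2Dsin2 (clip t1 t); have := cos2Dsin2 (clip t2 t).
have := sqr_ge0 (sin (clip t1 t) - sin (clip t2 t)).
lra.
Qed.

Lemma clipped_cosE (x y : R) : `|x - y| <= pi ->
  clipped_cos (ang x) (ang y) = cos (x - y).
Proof.
move=> xy; have pia : pi <= alpha / 2 by have := halpha; lra.
rewrite /clipped_cos adist_eq ?(le_trans xy)//.
by rewrite (min_idPl xy) cos_norm.
Qed.

(** Past pi, [cos (x - y)] is the cosine of [2 * pi - |x - y|]. On the kale the way round the other
    side has length [alpha - |x - y|], which is longer, so the clipped cosine is smaller. *)
Lemma clipped_cos_le (x y : R) : `|x - y| <= 2 * pi ->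
  clipped_cos (ang x) (ang y) <= cos (x - y).
Proof.
have ha := halpha; move=> xy; case: (leP `|x - y| pi) => [/clipped_cosE->//|xypi].
rewrite -[leRHS]cos_norm -[leRHS]cosN -[leRHS](@cosD2pi _) addrC.
rewrite /clipped_cos; apply: cos_le_homo.
- lra.
- rewrite le_min; apply/andP; split.
  + by apply: le_trans (adist_ge _ _); rewrite le_min; apply/andP; split; lra.
  + lra.
- by rewrite ge_min lexx orbT.
Qed.

(* Where [t] is within [pi] of [b], both neighbouring values are at most the true
   cosines, for which equality holds; elsewhere the value at [b] is [-1]. *)
Lemma clipped_cos_concave (t : angle alpha) (b u v : R) :
  0 <= u -> 0 <= v -> u + v <= pi ->
  sin v * clipped_cos t (ang (b - u)) + sin u * clipped_cos t (ang (b + v))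
    <= sin (u + v) * clipped_cos t (ang b).
Proof.
move=> u0 v0 uv; have [x [<- xb _]] := adist_rep t b.
have su : 0 <= sin u by apply: sin_ge0_pi; rewrite u0/=; lra.
have sv : 0 <= sin v by apply: sin_ge0_pi; rewrite v0/=; lra.
case: (leP `|x - b| pi) => xpi.
  have := xpi; rewrite ler_norml => /andP[xl xr].
  rewrite [X in _ <= _ * X]clipped_cosE//.
  have h1 : clipped_cos (ang x) (ang (b - u)) <= cos (x - b + u).
    rewrite (_ : x - b + u = x - (b - u)); last by ring.
    by apply: clipped_cos_le; rewrite ler_norml; apply/andP; split; lra.
  have h2 : clipped_cos (ang x) (ang (b + v)) <= cos (x - b - v).
    rewrite (_ : x - b - v = x - (b + v)); last by ring.
    by apply: clipped_cos_le; rewrite ler_norml; apply/andP; split; lra.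
  apply: (le_trans (lerD (ler_wpM2l sv h1) (ler_wpM2l su h2))).
  rewrite (cosD (x - b) u) (cosB (x - b) v) (sinD u v).
  by rewrite le_eqVlt; apply/orP; left; apply/eqP; ring.
have cb : clipped_cos (ang x) (ang b) = -1.
  by rewrite /clipped_cos -xb (min_idPr (ltW xpi)) cospi.
(* Moving by at most [w] from [b] leaves a distance of at least [pi - w] to [x]. With these bounds
   the claim reduces to the addition formula for [sin (u + v)]. *)
have H w c : 0 <= w <= pi -> `|c - b| <= w -> clipped_cos (ang x) (ang c) <= - cos w.
  move=> /andP[w0 wpi] cw; rewrite -cos_piB.
  rewrite /clipped_cos; apply: cos_le_homo; rewrite ?subr_ge0//.
    rewrite le_min gerBl w0 andbT.
    have := adist_triangle (ang x) (ang c) (ang b); rewrite -xb.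
    by have := adist_le c b; lra.
  by rewrite ge_min lexx orbT.
have h1 : clipped_cos (ang x) (ang (b - u)) <= - cos u.
  apply: H; first by rewrite u0/=; lra.
  by rewrite addrAC subrr add0r normrN ger0_norm.
have h2 : clipped_cos (ang x) (ang (b + v)) <= - cos v.
  apply: H; first by rewrite v0/=; lra.
  by rewrite addrAC subrr add0r ger0_norm.
rewrite cb (sinD u v); apply: (le_trans (lerD (ler_wpM2l sv h1) (ler_wpM2l su h2))).
by rewrite le_eqVlt; apply/orP; left; apply/eqP; ring.
Qed.

(** By the triangle inequality the two clipped distances add up to at least pi, and
    [cos (pi - x) = - cos x]. Injectivity of the cosine on [[0, pi]] gives the equality case. *)
Lemma clipped_cos_far (t a c : angle alpha) : pi <= adist a c ->
  clipped_cos t a + clipped_cos t c <= 0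
  /\ (clipped_cos t a + clipped_cos t c = 0 ->
       Num.min (adist t a) pi + Num.min (adist t c) pi = pi).
Proof.
move=> ac; have /andP[ha0 hap] := clip_itv t a; have /andP[hc0 hcp] := clip_itv t c.
have sum_ge : pi <= clip t a + clip t c.
  have := adist_triangle a t c; rewrite (adistC a t).
  have := adist_ge0 t a; have := adist_ge0 t c.
  rewrite /clip !minEle; case: (leP (adist t a)); case: (leP (adist t c)); lra.
have le : cos (clip t a) <= - cos (clip t c).
  rewrite -cos_piB; apply: cos_le_homo; lra.
rewrite /clipped_cos -/(clip t a) -/(clip t c); split; first lra.
move=> /eqP; rewrite addr_eq0 -cos_piB => /eqP H.
have -> : clip t a = pi - clip t c.
  by apply: cos_inj H; rewrite in_itv/=; apply/andP; split; lra.
by rewrite subrK.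
Qed.

(** Two unclipped distances would add up to more than pi, so one of them is clipped to pi and the
    other is [0]. *)
Lemma clipped_cos_far_eq0 (t a c : angle alpha) : pi < adist a c ->
  clipped_cos t a + clipped_cos t c = 0 -> t = a \/ t = c.
Proof.
move=> ac /(clipped_cos_far t (ltW ac)).2.
have := adist_triangle a t c; rewrite (adistC a t).
have := adist_ge0 t a; have := adist_ge0 t c.
rewrite !minEle; case: (leP (adist t a)) => ta; case: (leP (adist t c)) => tc.
- by move=> *; exfalso; lra.
- by move=> _ h _ H; left; apply: adist_eq0; lra.
- by move=> h _ _ H; right; apply: adist_eq0; lra.
- by move=> *; exfalso; have := pi_gt0 R; lra.
Qed.

Lemma clipped_cos_antipodal_eq0 (t : angle alpha) (a : R) :
  clipped_cos t (ang a) + clipped_cos t (ang (a + pi)) = 0 ->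
  exists2 x, 0 <= x <= pi & t = ang (a + x).
Proof.
have pi0 := pi_gt0 R; have ha := halpha.
have dac : adist (ang a) (ang (a + pi)) = pi.
  have E : a - (a + pi) = - pi by ring.
  by rewrite adist_eq E normrN ger0_norm ?pi_ge0//; lra.
have ac : pi <= adist (ang a) (ang (a + pi)) by rewrite dac.
move=> /(clipped_cos_far t ac).2.
have := adist_ge0 t (ang a); have := adist_ge0 t (ang (a + pi)).
have [x [<- xa xalpha]] := adist_rep t a; rewrite -xa.
rewrite !minEle; case: (leP `|x - a|) => ta; case: (leP (adist _ (ang (a + pi)))) => tc.
- move=> h1 h2 H; exists (x - a); last by congr ang; ring.
  (* On the other side of [a], both ways from [x] to [a + pi] are longer than [pi - |x - a|]: one
     has length [pi + |x - a|], the other [alpha - pi - |x - a|], and [alpha > 2 * pi]. *)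
  have x0 : 0 <= x - a.
    rewrite leNgt; apply/negP => xa0; rewrite ltr0_norm// in xa ta H h2.
    have := adist_ge x (a + pi).
    rewrite (_ : x - (a + pi) = - (pi - (x - a))); last by ring.
    rewrite normrN gtr0_norm; last by lra.
    by rewrite ge_min => /orP[]; lra.
  by rewrite x0/=; rewrite ger0_norm// in ta.
- move=> _ h2 H; exists 0; rewrite ?lexx ?pi_ge0// addr0.
  have /normr0P : `|x - a| = 0 by lra.
  by rewrite subr_eq0 => /eqP->.
- move=> h1 _ H; exists pi; rewrite ?lexx ?pi_ge0//.
  by apply: adist_eq0; lra.
- by move=> *; exfalso; lra.
Qed.

(** * The metric of the kale and its barycenters *)

Lemma fold1E (t t' : angle alpha) (r : {r : R | 0 < r}) :
  (fold t (Some (r, t'))).1 = val r * clipped_cos t' t.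
Proof.
rewrite /fold /clipped_cos; case: ifPn => [tpi|]; last first.
  by rewrite -ltNge => /ltW tpi; rewrite (min_idPr tpi).
rewrite (min_idPl tpi) /polar_to_cartesian/=; congr (_ * _).
(* Any representative in [[-pi, pi]] has absolute value [adist t' t], and the cosine is even. The
   default of [xget] is excluded because the nearest representative lies in that interval. *)
rewrite /adiff; case: xgetP => [x _ [xd /= xpi]|H].
  move: xd => [a [b [<- <- xE]]]; rewrite xE in xpi *.
  rewrite adist_eq ?cos_norm// ler_norml; have := halpha.
  by move: xpi => /andP[? ?] ?; apply/andP; split; lra.
exfalso; have [y yt] := angle_of_surj t; have [x [xt' xy _]] := adist_rep t' y.
apply: (H (x - y)); split => /=; first by exists x, y.
by rewrite -ler_norml xy yt.
Qed.

Lemma norm_fold1_le (t : angle alpha) p : `|(fold t p).1| <= kdist origin p.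
Proof.
case: p => [[r t']|]; last by rewrite normr0.
rewrite fold1E normrM ger0_norm ?ler_piMr ?clipped_cos_le1 ?(ltW (valP r))//.
Qed.

Lemma fold1_angle_lip (t t' : angle alpha) p :
  `|(fold t p).1 - (fold t' p).1| <= kdist origin p * adist t t'.
Proof.
case: p => [[r s]|]; last by rewrite subrr normr0 mul0r.
rewrite !fold1E -mulrBr normrM ger0_norm ?(ltW (valP r))//.
by rewrite ler_wpM2l ?clipped_cos_lip// (ltW (valP r)).
Qed.

Lemma kdist_ge0 (p q : kale alpha) : 0 <= kdist p q.
Proof.
case: p q => [[r t]|] [[s u]|] //=; rewrite ?(ltW (valP _))//.
by case: ifP => _; rewrite ?sqrtr_ge0// addr_ge0 ?(ltW (valP _)).
Qed.

Lemma kdist_sqr_fold (s : {r : R | 0 < r}) (t : angle alpha) (p : kale alpha) :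
  kdist (Some (s, t)) p ^+ 2 =
    val s ^+ 2 + kdist origin p ^+ 2 - 2 * val s * (fold t p).1.
Proof.
have s0 : 0 < sval s := valP s; case: p => [[r u]|] /=; last by ring.
have r0 : 0 < sval r := valP r; rewrite fold1E/=.
rewrite clipped_cosC /clipped_cos; case: ifPn => [tpi|]; last first.
  by rewrite -ltNge => /ltW tpi; rewrite (min_idPr tpi) cospi; ring.
rewrite (min_idPl tpi) sqr_sqrtr; first by ring.
have := cos_le1 (adist t u); have := cos_geN1 (adist t u).
have := sqr_ge0 (sval s - sval r).
have : 0 < sval s * sval r by rewrite mulr_gt0.
nra.
Qed.

(** The law of cosines with its radial and angular parts separated; both are nonnegative, so each is
    bounded by the squared distance. *)
Lemma kdist_sqr_clipped_cos (r s : {r : R | 0 < r}) (t u : angle alpha) :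
  kdist (Some (r, t)) (Some (s, u)) ^+ 2 =
    (val r - val s) ^+ 2 + 2 * val r * val s * (1 - clipped_cos t u).
Proof. by rewrite kdist_sqr_fold fold1E clipped_cosC /=; ring. Qed.

Lemma radius_lip (p q : kale alpha) :
  `|kdist origin p - kdist origin q| <= kdist p q.
Proof.
apply: ler_norm_of_sqr; first exact: kdist_ge0.
case: p q => [[r t]|] [[s u]|]; last 3 first.
- by rewrite subr0.
- by rewrite sub0r sqrrN.
- by rewrite subr0.
rewrite kdist_sqr_clipped_cos /= lerDl.
have := clipped_cos_le1 t u; rewrite ler_norml => /andP[_ c1].
have r0 : 0 < sval r := valP r; have s0 : 0 < sval s := valP s.
by rewrite !mulr_ge0 ?subr_ge0// ltW.
Qed.

(** The difference splits into the smaller radius times a difference of clipped cosines, plus the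
    difference of radii times a clipped cosine. Each summand is at most the distance; the first
    because the square of the smaller radius is at most [r * s]. *)
Lemma fold1_lip (t : angle alpha) (p q : kale alpha) :
  `|(fold t p).1 - (fold t q).1| <= 2 * kdist p q.
Proof.
case: p q => [[r u]|] [[s v]|]; last 3 first.
- rewrite subr0 (le_trans (norm_fold1_le _ _))//=.
  by have r0 : 0 < sval r := valP r; lra.
- rewrite sub0r normrN (le_trans (norm_fold1_le _ _))//=.
  by have s0 : 0 < sval s := valP s; lra.
- by rewrite subrr normr0 mulr0.
have r0 : 0 < sval r := valP r; have s0 : 0 < sval s := valP s.
set k := kdist (Some (r, u)) (Some (s, v)).
have hr : `|kdist origin (Some (r, u)) - kdist origin (Some (s, v))| <= k.
  exact: radius_lip.
have k0 : 0 <= k by exact: kdist_ge0.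
have hc : sval r * sval s * (clipped_cos u t - clipped_cos v t) ^+ 2 <= k ^+ 2.
  rewrite kdist_sqr_clipped_cos /=.
  have := ler_wpM2l (ltW (mulr_gt0 r0 s0)) (sqr_clipped_cosB_le t u v).
  by have := sqr_ge0 (sval r - sval s); lra.
rewrite !fold1E/= in hr *.
have cu := clipped_cos_le1 u t; have cv := clipped_cos_le1 v t.
case: (leP (sval r) (sval s)) => rs.
  have H : `|sval r * (clipped_cos u t - clipped_cos v t)| <= k.
    apply: ler_norm_of_sqr => //; apply: le_trans hc.
    by rewrite exprMn ler_wpM2r ?sqr_ge0// expr2 ler_wpM2l// ltW.
  have H2 : `|(sval r - sval s) * clipped_cos v t| <= k.
    by rewrite normrM (le_trans _ hr)// ler_piMr.
  rewrite [X in `|X|](_ : _ = sval r * (clipped_cos u t - clipped_cos v t) +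
    (sval r - sval s) * clipped_cos v t); last by ring.
  by rewrite (le_trans (ler_normD _ _))// mulr_natl mulr2n lerD.
have H : `|sval s * (clipped_cos u t - clipped_cos v t)| <= k.
  apply: ler_norm_of_sqr => //; apply: le_trans hc.
  by rewrite exprMn ler_wpM2r ?sqr_ge0// expr2 ler_wpM2r// ltW.
have H2 : `|(sval r - sval s) * clipped_cos u t| <= k.
  by rewrite normrM (le_trans _ hr)// ler_piMr.
rewrite [X in `|X|](_ : _ = sval s * (clipped_cos u t - clipped_cos v t) +
  (sval r - sval s) * clipped_cos u t); last by ring.
by rewrite (le_trans (ler_normD _ _))// mulr_natl mulr2n lerD.
Qed.

(* The triangle inequality for [kdist] is never needed: radius and folding are
   directly Lipschitz, which suffices for measurability. *)
Lemma kale_lipschitz_measurable (f : borel_kale alpha -> R) (C : R) : 0 < C ->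
  (forall p q, `|f p - f q| <= C * kdist p q) ->
  measurable_fun [set: borel_kale alpha] f.
Proof.
move=> C0 fC; apply: (measurability _ (RGenOInfty.measurableE R)) => //.
move=> _ [_ [x ->] <-]; rewrite setTI; apply: sub_sigma_algebra => p /=.
rewrite in_itv/= andbT => xp; exists ((f p - x) / C).
  by rewrite divr_gt0// subr_gt0.
move=> q; rewrite ltr_pdivlMr// => pq; rewrite /= in_itv/= andbT.
have := fC p q; have := ler_norm (f p - f q); lra.
Qed.

Lemma measurable_radius : measurable_fun [set: borel_kale alpha] (kdist origin).
Proof.
by apply: (@kale_lipschitz_measurable _ 1) => // p q; rewrite mul1r radius_lip.
Qed.

Lemma measurable_fold1 (t : angle alpha) :
  measurable_fun [set: borel_kale alpha] (fun p => (fold t p).1).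
Proof. by apply: (@kale_lipschitz_measurable _ 2) => // p q; exact: fold1_lip. Qed.

(** The clipped cosine equals [1] only at angle [t] itself. This form exhibits a ray as a measurable
    set. *)
Lemma rayE (t : angle alpha) :
  ray t = [set p | kdist origin p = (fold t p).1].
Proof.
apply/seteqP; split=> [p [r r0 ->]|[[r u]|]].
- rewrite /mkset /polar; case: insubP => [r' _ _|_] //.
  have [x <-] := angle_of_surj t.
  by rewrite fold1E clipped_cosE ?subrr ?normr0 ?pi_ge0// cos0 mulr1.
- have r0 : 0 < sval r := valP r.
  rewrite /mkset fold1E/= => /esym/eqP.
  rewrite -subr_eq0 -{2}[sval r]mulr1 -mulrBr mulf_eq0 gt_eqF//= subr_eq0.
  move=> /eqP c1; exists (sval r); first exact: ltW.
  rewrite /polar (valK r) (_ : u = t)//; apply: adist_eq0.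
  have : cos (clip u t) = cos 0 by rewrite cos0.
  have /andP[c0 cpi] := clip_itv u t.
  move=> /cos_inj; rewrite !in_itv/= c0 cpi lexx pi_ge0 => /(_ isT isT).
  by rewrite /clip minEle; case: ifP => // _ /eqP; rewrite gt_eqF// pi_gt0.
- by move=> _; exists 0 => //; rewrite /polar insubF// ltxx.
Qed.

Lemma measurable_ray (t : angle alpha) :
  measurable (ray t : set (borel_kale alpha)).
Proof.
rewrite rayE -[X in measurable X]setTI (_ : [set p | _] =
  [set p | kdist origin p <= (fold t p).1]).
  exact: measurable_fun_le measurableT measurable_radius (measurable_fold1 t).
apply/seteqP; split=> p /= => [->//|pt]; apply/eqP; rewrite eq_le pt/=.
exact: le_trans (ler_norm _) (norm_fold1_le _ _).
Qed.

(** * Topology of the circle of angles *)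

Lemma angle_of_continuous : continuous (ang : R -> angle alpha).
Proof. exact: pi_continuous. Qed.

Lemma angle_compact : compact [set: angle alpha].
Proof.
rewrite (_ : setT = ang @` `[0, alpha]%classic).
  apply: continuous_compact; last exact: segment_compact.
  by apply: continuous_subspaceT => x; exact: angle_of_continuous.
apply/esym/seteqP; split=> // t _.
have [x [<- _ xa]] := adist_rep t (alpha / 2); exists x => //=.
by rewrite in_itv/=; move: xa; rewrite ler_norml => /andP[? ?]; apply/andP; split; lra.
Qed.

Lemma angle_lip_continuous (g : angle alpha -> R) (C : R) :
  (forall t t', `|g t - g t'| <= C * adist t t') -> continuous g.
Proof.
move=> gC.
have C0 : 0 < `|C| + 1 by rewrite ltr_wpDl.
apply/quotient_continuous => x; apply/cvgrPdist_lt => e e0; near=> y.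
have xy : `|x - y| < e / (`|C| + 1).
  near: y; apply: cvgr_dist_lt; last by rewrite divr_gt0.
  exact: cvg_id.
rewrite /comp (le_lt_trans (gC _ _))//.
have := adist_le x y; have := adist_ge0 (ang x) (ang y).
rewrite ltr_pdivlMr// in xy; have := ler_norm C.
have := normr_ge0 C; rewrite -/(ang x) -/(ang y); nra.
Unshelve. all: by end_near. Qed.

Lemma angle_argmax (g : angle alpha -> R) (C : R) (D : set (angle alpha)) :
  (forall t t', `|g t - g t'| <= C * adist t t') -> closed D -> D !=set0 ->
  exists2 t, D t & forall t', D t' -> g t' <= g t.
Proof.
move=> gC cD D0.
have [||t tD tmax] := @compact_EVT_max _ _ g D D0.
- by rewrite -(setTI D); apply: compact_closedI => //; exact: angle_compact.
- by apply: continuous_subspaceT; exact: angle_lip_continuous gC.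
- exists t; first by rewrite inE in tD.
  by move=> t' D'; apply: tmax; rewrite inE.
Qed.

Lemma open_arc_open (x y : R) : open (open_arc alpha x y).
Proof.
suff : open (ang @^-1` open_arc alpha x y) by [].
rewrite (_ : _ @^-1` _ = \bigcup_(n in [set: int])
    `]x - n%:~R * alpha, y - n%:~R * alpha[%classic).
  by apply: bigcup_open => n _; exact: itv_open.
apply/seteqP; split=> z /=.
  move=> [w /= wxy /esym/angle_of_eqP[n wE]]; exists n => //=.
  by rewrite in_itv/= ltrBlDl ltrBrDl -wE.
move=> [n _ /=]; rewrite in_itv/= ltrBlDl ltrBrDl => nz.
by exists (n%:~R * alpha + z) => //=; exact: angle_ofDz.
Qed.

(** * Barycenters of finite samples *)

Section barycenter.
Variables (N : nat) (p : nat -> kale alpha).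
Hypothesis N0 : (0 < N)%N.

Definition mean_fold1 (M : nat) (q : nat -> kale alpha) (t : angle alpha) : R :=
  (\sum_(i < M) (fold t (q i)).1) / M%:R.

Let NR0 : 0 < N%:R :> R. Proof. by rewrite ltr0n. Qed.

Lemma mean_fold1_lip (t t' : angle alpha) :
  `|mean_fold1 N p t - mean_fold1 N p t'|
    <= (\sum_(i < N) kdist origin (p i)) / N%:R * adist t t'.
Proof.
rewrite /mean_fold1 -mulrBl -sumrB normrM [`|_^-1|]ger0_norm ?invr_ge0 ?(ltW NR0)//.
rewrite [leRHS]mulrAC ler_wpM2r ?invr_ge0 ?(ltW NR0)// mulr_suml.
rewrite (le_trans (ler_norm_sum _ _ _))//.
by apply: ler_sum => i _; exact: fold1_angle_lip.
Qed.

Lemma frechet_polar (s : {r : R | 0 < r}) (t : angle alpha) :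
  frechet N p (Some (s, t)) =
  frechet N p origin + val s ^+ 2 / 2 - val s * mean_fold1 N p t.
Proof.
rewrite /frechet (_ : \sum_(n < N) kdist (Some (s, t)) (p n) ^+ 2 =
    val s ^+ 2 *+ N + \sum_(n < N) kdist origin (p n) ^+ 2
    - 2 * val s * \sum_(n < N) (fold t (p n)).1).
  rewrite /mean_fold1 -mulr_natr; field.
  by rewrite gt_eqF.
transitivity (\sum_(n < N) (val s ^+ 2 + kdist origin (p n) ^+ 2
    - 2 * val s * (fold t (p n)).1)).
  by apply: eq_bigr => i _; exact: kdist_sqr_fold.
by rewrite sumrB big_split sumr_const card_ord mulr_sumr.
Qed.

(** In the direction [t] the objective is [s^2 / 2 - s * m_N t] up to a constant, least at
    [s = m_N t] when this is positive. A maximizer of [m_N] on the compact circle supplies a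
    minimizer, so [xget] does not return its default, and the description is valid for every
    minimizer it may choose. *)
Lemma barycenterP :
  (barycenter N p = origin /\ forall t, mean_fold1 N p t <= 0) \/
  (exists s t, [/\ barycenter N p = Some (s, t), mean_fold1 N p t = val s &
                   forall t', mean_fold1 N p t' <= mean_fold1 N p t]).
Proof.
have [t1 _ max1] := angle_argmax mean_fold1_lip closedT (ex_intro _ (ang 0) I).
rewrite /barycenter; case: xgetP => [b _ /= bmin|nomin]; last first.
  exfalso; case: (leP (mean_fold1 N p t1) 0) => [le0|gt0].
    apply: (nomin origin) => -[[s t]|] //=; rewrite frechet_polar -addrA lerDl.
    have s0 : 0 < sval s := valP s; have := max1 t I.
    have := sqr_ge0 (sval s); rewrite /=; nra.
  apply: (nomin (Some (exist (fun r : R => 0 < r) _ gt0, t1))) => -[[s t]|] /=.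
    have s0 : 0 < sval s := valP s; have := max1 t I.
    rewrite !frechet_polar/=.
    have := sqr_ge0 (sval s - mean_fold1 N p t1); nra.
  by rewrite frechet_polar/=; nra.
case: b bmin => [[s t]|] bmin; [right|left].
  have s0 : 0 < sval s := valP s.
  have h0 := bmin origin; rewrite frechet_polar/= -addrA gerDl in h0.
  have m0 : 0 < mean_fold1 N p t by nra.
  have mE : mean_fold1 N p t = val s.
    have := bmin (Some (exist (fun r : R => 0 < r) _ m0, t)).
    rewrite !frechet_polar/= => h1.
    have : (sval s - mean_fold1 N p t) ^+ 2 <= 0 by nra.
    by rewrite le_eqVlt ltNge sqr_ge0 orbF sqrf_eq0 subr_eq0 => /eqP.
  exists s, t; split => // t'; rewrite leNgt; apply/negP => tt'.
  have m0' : 0 < mean_fold1 N p t' by exact: lt_trans tt'.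
  have := bmin (Some (exist (fun r : R => 0 < r) _ m0', t')).
  rewrite !frechet_polar/= mE in tt' *.
  by rewrite -!addrA lerD2l; move: s0 tt'; rewrite /=; nra.
split=> // t; rewrite leNgt; apply/negP => m0.
have := bmin (Some (exist (fun r : R => 0 < r) _ m0, t)).
by rewrite frechet_polar/= -addrA lerDl; nra.
Qed.
End barycenter.

(** * The shape of the folded moment *)

Lemma ray_polar (r : {r : R | 0 < r}) (t : angle alpha) : ray t (Some (r, t)).
Proof. by exists (val r); [exact: ltW (valP r)|rewrite /polar valK]. Qed.

Lemma ray_origin (t : angle alpha) : ray t origin.
Proof. by exists 0 => //; rewrite /polar insubF// ltxx. Qed.

Section first_moment.
Variable mu : probability (borel_kale alpha) R.
Hypothesis mu_nondeg : nondegenerate_measure mu.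
Hypothesis mu_moment :
  (\int[mu]_(p in [set: borel_kale alpha]) (kdist origin p)%:E < +oo)%E.

Lemma integrable_radius :
  mu.-integrable [set: borel_kale alpha] (EFin \o kdist origin).
Proof.
apply/integrableP; split; first by apply/measurable_EFinP; exact: measurable_radius.
apply: le_lt_trans mu_moment; rewrite le_eqVlt; apply/orP; left; apply/eqP.
by apply: eq_integral => p _; rewrite gee0_abs ?lee_fin ?kdist_ge0.
Qed.

Lemma integrable_fold1 (t : angle alpha) :
  mu.-integrable [set: borel_kale alpha] (EFin \o (fun p => (fold t p).1)).
Proof.
apply: le_integrable integrable_radius => //.
  by apply/measurable_EFinP; exact: measurable_fold1.
move=> p _; rewrite lee_fin [leRHS]ger0_norm ?kdist_ge0//.
exact: norm_fold1_le.
Qed.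

Let m (t : angle alpha) : R := (folded_moment mu t).1.

Lemma folded_moment_lip (t t' : angle alpha) :
  `|m t - m t'| <= (\int[mu]_p kdist origin p) * adist t t'.
Proof.
rewrite /m/= -RintegralB ?(integrable_fold1)//.
have iB : mu.-integrable [set: borel_kale alpha]
    (EFin \o (fun p => (fold t p).1 - (fold t' p).1)).
  exact: integrableB (integrable_fold1 t) (integrable_fold1 t').
apply: (le_trans (le_normr_Rintegral _ _)) => //.
rewrite -RintegralZr//; last exact: integrable_radius.
apply: le_Rintegral => //.
- exact: integrable_abse iB.
- exact: integrableZr integrable_radius.
- by move=> p _; exact: fold1_angle_lip.
Qed.

Lemma RintegralD_fold1 (t t' : angle alpha) (c c' : R) :
  mu.-integrable [set: borel_kale alpha]
    (EFin \o (fun p => c * (fold t p).1 + c' * (fold t' p).1)) /\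
  \int[mu]_p (c * (fold t p).1 + c' * (fold t' p).1) = c * m t + c' * m t'.
Proof.
have i1 : mu.-integrable [set: borel_kale alpha]
    (EFin \o (fun p => c * (fold t p).1)).
  exact: integrableZl (integrable_fold1 t).
have i2 : mu.-integrable [set: borel_kale alpha]
    (EFin \o (fun p => c' * (fold t' p).1)).
  exact: integrableZl (integrable_fold1 t').
split; first exact: integrableD i1 i2.
by rewrite RintegralD// !RintegralZl//; exact: integrable_fold1.
Qed.

Lemma folded_moment_concave (b u v : R) : 0 <= u -> 0 <= v -> u + v <= pi ->
  sin v * m (ang (b - u)) + sin u * m (ang (b + v)) <= sin (u + v) * m (ang b).
Proof.
move=> u0 v0 uv.
have [i1 <-] := RintegralD_fold1 (ang (b - u)) (ang (b + v)) (sin v) (sin u).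
rewrite -RintegralZl//; last exact: integrable_fold1.
apply: le_Rintegral => //; first exact: integrableZl (integrable_fold1 _).
move=> [[r t]|] _; last by rewrite /= !mulr0 addr0.
have r0 : 0 < val r := valP r; rewrite !fold1E.
have := ler_wpM2l (ltW r0) (clipped_cos_concave t b u0 v0 uv); lra.
Qed.

Lemma ae_eq0_of_le0 (f : borel_kale alpha -> R) :
  mu.-integrable [set: borel_kale alpha] (EFin \o f) ->
  {ae mu, forall p : borel_kale alpha, f p <= 0} -> 0 <= \int[mu]_p f p ->
  {ae mu, forall p : borel_kale alpha, f p = 0}.
Proof.
move=> fi f0 If.
have mf : measurable_fun [set: borel_kale alpha] (EFin \o f).
  exact: measurable_int fi.
have absE : (\int[mu]_p `|(EFin \o f) p| = - \int[mu]_p (EFin \o f) p)%E.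
  rewrite -integralN ?integrable_add_def//; apply: ae_eq_integral => //.
  - exact: measurableT_comp.
  - exact: measurableT_comp.
  - by apply: filterS f0 => p fp _ /=; rewrite ler0_norm// EFinN.
have /(ae_eq_integral_abs mu measurableT mf) : (\int[mu]_p `|(EFin \o f) p| = 0)%E.
  apply/eqP; rewrite eq_le integral_ge0// andbT absE.
  have /fineK <- : (\int[mu]_p (EFin \o f) p \is a fin_num)%E.
    exact: integrable_fin_num.
  by rewrite -EFinN lee_fin oppr_le0.
by apply: filterS => p /(_ Logic.I)/= [].
Qed.

(** The form in which nondegeneracy contradicts the equality cases below. *)
Lemma not_ae_rays (t t' : angle alpha) : pi <= adist t t' ->
  ~ {ae mu, forall p : borel_kale alpha, (ray t `|` ray t') p}.
Proof.
move=> /mu_nondeg mu1 aeR.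
have mR : measurable (ray t `|` ray t' : set (borel_kale alpha)).
  by apply: measurableU; exact: measurable_ray.
have : mu (~` (ray t `|` ray t')) = 0%E.
  by apply/negligibleP => //; exact: measurableC.
rewrite probability_setC//; move: mu1.
have /fineK <- : mu (ray t `|` ray t') \is a fin_num by exact: fin_num_measure.
by rewrite lte_fin -EFinB => r1 [r0]; lra.
Qed.

(** The integrand is nonpositive. Were its integral nonnegative, it would vanish almost everywhere,
    and [mu] would be carried by the two rays. *)
Lemma folded_moment_far (t t' : angle alpha) : pi < adist t t' -> m t + m t' < 0.
Proof.
move=> tt'; rewrite ltNge; apply/negP => m0.
apply: (not_ae_rays (ltW tt')).
have [i1 i1E] := RintegralD_fold1 t t' 1 1.
have := ae_eq0_of_le0 i1; rewrite i1E !mul1r => H.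
have foldD r u : 1 * (fold t (Some (r, u))).1 + 1 * (fold t' (Some (r, u))).1
    = val r * (clipped_cos u t + clipped_cos u t').
  by rewrite !fold1E; ring.
have le0 p : 1 * (fold t p).1 + 1 * (fold t' p).1 <= 0.
  case: p => [[r u]|]; last by rewrite /= !mulr0 addr0.
  rewrite foldD pmulr_rle0 ?(valP r)//.
  exact: (clipped_cos_far u (ltW tt')).1.
have : {ae mu, forall p : borel_kale alpha, 1 * (fold t p).1 + 1 * (fold t' p).1 <= 0}.
  by apply: aeW => p; exact: le0.
move=> /H/(_ m0); apply: filterS => -[[r u]|] /=; last first.
  by move=> _; left; exact: ray_origin.
rewrite -/(fold t (Some (r, u))) -/(fold t' (Some (r, u))) foldD => /eqP.
rewrite mulf_eq0 gt_eqF ?(valP r)//= => /eqP.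
by move=> /(clipped_cos_far_eq0 tt')[->|->]; [left|right]; exact: ray_polar.
Qed.

(** The two moments have a nonpositive sum, so both vanish and [mu] is carried by the sector from
    [a] to [a + pi]. At angle [a + x] of that sector, [cos (x - s) = cos s * cos x + sin s * sin x];
    the first term integrates to a multiple of [m (ang a)], which is [0], and the second is
    nonnegative. If its integral vanished, [sin x] would be [0] almost everywhere, again leaving
    only the two rays. *)
Lemma folded_moment_antipodal (a s : R) : 0 < s < pi ->
  0 <= m (ang a) -> 0 <= m (ang (a + pi)) -> 0 < m (ang (a + s)).
Proof.
move=> /andP[s0 spi] ma mc; have pi0 := pi_gt0 R.
have dac : adist (ang a) (ang (a + pi)) = pi.
  have E : a - (a + pi) = - pi by ring.
  by rewrite adist_eq E normrN ger0_norm ?pi_ge0//; have := halpha; lra.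
have ac : pi <= adist (ang a) (ang (a + pi)) by rewrite dac.
have foldD r u : 1 * (fold (ang a) (Some (r, u))).1 +
    1 * (fold (ang (a + pi)) (Some (r, u))).1
    = val r * (clipped_cos u (ang a) + clipped_cos u (ang (a + pi))).
  by rewrite !fold1E; ring.
have [i1 i1E] := RintegralD_fold1 (ang a) (ang (a + pi)) 1 1.
have le0 p : 1 * (fold (ang a) p).1 + 1 * (fold (ang (a + pi)) p).1 <= 0.
  case: p => [[r u]|]; last by rewrite /= !mulr0 addr0.
  rewrite foldD pmulr_rle0 ?(valP r)//.
  exact: (clipped_cos_far u ac).1.
have m0 : m (ang a) + m (ang (a + pi)) = 0.
  apply/eqP; rewrite eq_le addr_ge0// andbT -[m (ang a)]mul1r -[m (ang (a + pi))]mul1r.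
  rewrite -i1E -(Rintegral_probability_cst mu 0); apply: le_Rintegral => //.
  by apply: (@bounded_integrable _ _ _ _ _ 0) => // x; rewrite normr0.
have ma0 : m (ang a) = 0 by lra.
have ae0 : {ae mu, forall p : borel_kale alpha,
    1 * (fold (ang a) p).1 + 1 * (fold (ang (a + pi)) p).1 = 0}.
  by apply: ae_eq0_of_le0 => //; [by apply: aeW => p; exact: le0|rewrite i1E !mul1r m0].
have ss : 0 < sin s by apply: sin_gt0_pi; rewrite s0.
have key r u : 1 * (fold (ang a) (Some (r, u))).1 +
    1 * (fold (ang (a + pi)) (Some (r, u))).1 = 0 ->
    exists2 x, 0 <= x <= pi & u = ang (a + x) /\
    -1 * (fold (ang (a + s)) (Some (r, u))).1 + cos s * (fold (ang a) (Some (r, u))).1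
    = - (val r * (sin s * sin x)).
  rewrite foldD => /eqP; rewrite mulf_eq0 gt_eqF ?(valP r)//= => /eqP.
  move=> /clipped_cos_antipodal_eq0[x /andP[x0 xpi] ->]; exists x; first by rewrite x0.
  split=> //; rewrite !fold1E !clipped_cosE; last 2 first.
  - by rewrite [a + x]addrC addrK ger0_norm.
  - rewrite opprD addrACA subrr add0r ler_norml lerBrDl lerBlDl.
    rewrite (le_trans (ltW spi)) ?lerDl//= lerBlDr (le_trans xpi)// lerDl.
    exact: ltW.
  rewrite (_ : a + x - (a + s) = x - s); last by ring.
  rewrite (_ : a + x - a = x); last by ring.
  by rewrite cosB /=; ring.
rewrite ltNge; apply/negP => ms; apply: (not_ae_rays ac).
have [i2 i2E] := RintegralD_fold1 (ang (a + s)) (ang a) (-1) (cos s).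
have le2 : {ae mu, forall p : borel_kale alpha,
    -1 * (fold (ang (a + s)) p).1 + cos s * (fold (ang a) p).1 <= 0}.
  move: (ae0); apply: filterS => -[[r u]|]; last by rewrite /= !mulr0 addr0.
  move=> /key[x x0pi [_ ->]]; rewrite oppr_le0.
  by rewrite !mulr_ge0 ?(sin_ge0_pi x0pi) ?(ltW ss) ?(ltW (valP r)).
have := ae_eq0_of_le0 i2 le2.
rewrite i2E ma0 mulr0 addr0 mulN1r oppr_ge0 => /(_ ms) H.
move: ae0 H; apply: filterS2 => -[[r u]|]; last by move=> _ _; left; exact: ray_origin.
move=> /key[x /andP[x0 xpi] [-> ->]] /eqP.
rewrite oppr_eq0 mulf_eq0 (gt_eqF (valP r))/= mulf_eq0 (gt_eqF ss)/= => /eqP sx.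
have [x00|x00] := eqVneq x 0.
  by left; rewrite x00 addr0; exact: ray_polar.
have [xpi0|xpi0] := eqVneq x pi.
  by right; rewrite xpi0; exact: ray_polar.
have : 0 < sin x by apply: sin_gt0_pi; rewrite !lt_neqAle x0 xpi xpi0 eq_sym x00.
by rewrite sx ltxx.
Qed.
End first_moment.

(** * Functions on the circle that lie above their trigonometric interpolants *)

Section trigonometric_concavity.
Variable m : angle alpha -> R.
Hypothesis m_concave : forall b u v, 0 <= u -> 0 <= v -> u + v <= pi ->
  sin v * m (ang (b - u)) + sin u * m (ang (b + v)) <= sin (u + v) * m (ang b).
Hypothesis m_far : forall t t', pi < adist t t' -> m t + m t' < 0.
Hypothesis m_antipodal : forall a s, 0 < s < pi ->
  0 <= m (ang a) -> 0 <= m (ang (a + pi)) -> 0 < m (ang (a + s)).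

Lemma concave_between (a b c : R) : a <= b -> b <= c -> c - a < pi ->
  0 <= m (ang a) -> 0 <= m (ang c) -> 0 <= m (ang b).
Proof.
rewrite le_eqVlt => /predU1P[->//|ab].
rewrite le_eqVlt => /predU1P[->//|bc] ca ma mc.
have u0 : 0 <= b - a by lra. have v0 : 0 <= c - b by lra.
have uv : b - a + (c - b) <= pi by lra.
have := m_concave b u0 v0 uv.
rewrite (_ : b - (b - a) = a); last by ring.
rewrite (_ : b + (c - b) = c); last by ring.
have suv : 0 < sin (b - a + (c - b)).
  by apply: sin_gt0_pi; apply/andP; split; lra.
have sv : 0 <= sin (c - b) by apply: sin_ge0_pi; apply/andP; split; lra.
have su : 0 <= sin (b - a) by apply: sin_ge0_pi; apply/andP; split; lra.
move=> H; rewrite -(pmulr_rge0 _ suv); apply: le_trans H.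
by rewrite addr_ge0// mulr_ge0.
Qed.

Lemma concave_between_gt0 (a b c : R) : a < b -> b < c -> c - a < pi ->
  0 <= m (ang a) -> 0 <= m (ang c) -> 0 < m (ang a) + m (ang c) ->
  0 < m (ang b).
Proof.
move=> ab bc ca ma mc mac.
have u0 : 0 <= b - a by lra. have v0 : 0 <= c - b by lra.
have uv : b - a + (c - b) <= pi by lra.
have := m_concave b u0 v0 uv.
rewrite (_ : b - (b - a) = a); last by ring.
rewrite (_ : b + (c - b) = c); last by ring.
have suv : 0 < sin (b - a + (c - b)).
  by apply: sin_gt0_pi; apply/andP; split; lra.
have sv : 0 < sin (c - b) by apply: sin_gt0_pi; apply/andP; split; lra.
have su : 0 < sin (b - a) by apply: sin_gt0_pi; apply/andP; split; lra.
move=> H; rewrite -(pmulr_rgt0 _ suv); apply: lt_le_trans H.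
case: (ltP 0 (m (ang a))) => ma0.
  by rewrite ltr_pwDl ?mulr_gt0// mulr_ge0// ltW.
by rewrite ltr_wpDl ?mulr_gt0 ?mulr_ge0 ?(ltW sv)//; lra.
Qed.

(** The case [u = v = pi / 2], where the right-hand side has the factor [sin pi = 0]. *)
Lemma concave_antipodal_le0 (a : R) : m (ang a) + m (ang (a + pi)) <= 0.
Proof.
have p0 := pi_gt0 R; have h0 : 0 <= pi / 2 :> R by lra.
have hh : pi / 2 + pi / 2 <= pi :> R by lra.
have := m_concave (a + pi / 2) h0 h0 hh.
rewrite addrK -addrA -splitr sinpi sin_pihalf; lra.
Qed.

Lemma adist_le_pi (t t' : angle alpha) : 0 <= m t -> 0 <= m t' ->
  adist t t' <= pi.
Proof.
by move=> mt mt'; rewrite leNgt; apply/negP => /m_far; lra.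
Qed.

(** Two maximizers are at most pi apart. At their midpoint, at distance [h] from both, concavity
    divided by [2 * sin h] bounds the maximum by [cos h] times the value there, and [cos h < 1]. *)
Lemma concave_max_unique (t t' : angle alpha) : 0 < m t ->
  (forall u, m u <= m t) -> m t' = m t -> t' = t.
Proof.
move=> mt tmax mt'.
have tt' : adist t' t <= pi by apply: adist_le_pi; lra.
have [x0 tE] := angle_of_surj t; rewrite -tE in mt tmax mt' tt' *.
have [x [xE xx0 _]] := adist_rep t' x0; rewrite -xx0 in tt'; rewrite -xE in mt' *.
have main (y z : R) : y < z -> z - y <= pi ->
    m (ang y) = m (ang x0) -> m (ang z) = m (ang x0) -> False.
  move=> yz zy my mz; set h := (z - y) / 2.
  have h0 : 0 < h by rewrite divr_gt0// subr_gt0.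
  have hpi : h + h <= pi by rewrite /h -splitr.
  have := m_concave (y + h) (ltW h0) (ltW h0) hpi.
  have hE : y + h + h = z by rewrite -addrA -splitr addrC subrK.
  rewrite addrK hE my mz.
  have sh : 0 < sin h.
    by apply: sin_gt0_pi; rewrite h0/=; have := pi_gt0 R; lra.
  have ch : 0 <= cos h < 1.
    apply/andP; split.
      by apply: cos_ge0_pihalf; apply/andP; split; lra.
    rewrite -[ltRHS]cos0 ltr_cos ?in_itv/= ?lexx ?pi_ge0//.
    by apply/andP; split; lra.
  have mh := tmax (ang (y + h)).
  rewrite (_ : sin (h + h) = 2 * sin h * cos h); last by rewrite sinD; ring.
  move: ch mh => /andP[ch0 ch1] mh.
  have : cos h * m (ang (y + h)) < m (ang x0) by nra.
  rewrite -(ltr_pM2l sh); lra.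
have [->//|xneq] := eqVneq x x0.
move: tt'; rewrite ler_norml => /andP[tt1 tt2].
exfalso; move: xneq; rewrite neq_lt => /orP[xlt|xgt].
  by apply: (main x x0) => //; lra.
by apply: (main x0 x) => //; lra.
Qed.

(** A point slightly beyond [y], seen from [x0], still has a nonnegative value, so [y] lies strictly
    between two points to which strict concavity applies. Distance exactly pi from [x0] is excluded
    by the antipodal inequality. *)
Lemma concave_pos_near (x0 y : R) : 0 < m (ang x0) ->
  (\forall z \near y, 0 <= m (ang z)) -> `|y - x0| <= pi -> 0 < m (ang y).
Proof.
move=> m0 /nbhs_ballP[e /= e0 ye] yx0.
have my z : `|y - z| < e -> 0 <= m (ang z) by move=> yz; exact: ye.
have p0 := pi_gt0 R.
have yy : 0 <= m (ang y) by apply: my; rewrite subrr normr0.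
have yx1 : y - x0 != pi.
  apply/eqP => yE; have := concave_antipodal_le0 x0.
  by rewrite (_ : x0 + pi = y); lra.
have yx2 : y - x0 != - pi.
  apply/eqP => yE; have := concave_antipodal_le0 y.
  by rewrite (_ : y + pi = x0); lra.
move: yx0; rewrite ler_norml !le_eqVlt eq_sym (negbTE yx1) (negbTE yx2)/=.
move=> /andP[yl yr].
have [->//|yneq] := eqVneq y x0.
move: yneq; rewrite neq_lt => /orP[ylt|ygt].
  (* The first bound keeps [y - d] in the ball where [m] is nonnegative, the second keeps it less
     than pi away from [x0]. *)
  pose d := Num.min (e / 2) ((pi + (y - x0)) / 2).
  have d0 : 0 < d by rewrite lt_min !divr_gt0//; lra.
  have de : d <= e / 2 by rewrite ge_min lexx.
  have dp : d <= (pi + (y - x0)) / 2 by rewrite ge_min lexx orbT.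
  have md : 0 <= m (ang (y - d)).
    by apply: my; rewrite opprB addrC subrK gtr0_norm//; lra.
  by apply: (@concave_between_gt0 (y - d) y x0) => //; lra.
pose d := Num.min (e / 2) ((pi - (y - x0)) / 2).
have d0 : 0 < d by rewrite lt_min !divr_gt0//; lra.
have de : d <= e / 2 by rewrite ge_min lexx.
have dp : d <= (pi - (y - x0)) / 2 by rewrite ge_min lexx orbT.
have md : 0 <= m (ang (y + d)).
  by apply: my; rewrite opprD addrA subrr add0r normrN gtr0_norm//; lra.
by apply: (@concave_between_gt0 x0 y (y + d)) => //; lra.
Qed.

Hypothesis m_cont : continuous m.

(** One positive value makes the measure nonsticky: every angle with a nonnegative value is within
    pi of [t0], so the preceding lemma reaches the whole interior. *)
Lemma concave_pos_interior (t0 : angle alpha) : 0 < m t0 ->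
  interior [set t | 0 <= m t] !=set0 /\
  forall t, interior [set t | 0 <= m t] t -> 0 < m t.
Proof.
move=> m0; split.
  exists t0; move/cvgrPdist_lt : (@m_cont t0) => /(_ _ m0).
  rewrite /interior; apply: filterS => t /= h.
  by have := ler_norm (m t0 - m t); lra.
have [x0 x0E] := angle_of_surj t0.
move=> t tint; have mt : 0 <= m t by exact: interior_subset tint.
have [y [yE yx0 _]] := adist_rep t x0; rewrite -yE.
apply: (concave_pos_near (x0 := x0)); rewrite ?x0E//; last first.
  by rewrite yx0 x0E; apply: adist_le_pi => //; exact: ltW.
rewrite -yE in tint.
exact: (angle_of_continuous tint).
Qed.

(** Every angle with a nonnegative value has a representative in [[x0 - pi, x0 + pi]]; [A] and [B]
    are the extreme ones. Two such points exactly pi apart would force a positive value between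
    them, so [A] and [B] are less than pi from [x0], and concavity fills the gaps. Then
    [A + pi <= B] would make [A + pi] such a point, pi away from [A]. *)
Lemma concave_nonpos_arc : (forall t, m t <= 0) -> (exists t, 0 <= m t) ->
  exists A B : R, [/\ A <= B, B < A + pi &
    [set t | 0 <= m t] = closed_arc alpha A B].
Proof.
move=> mle [t0]; have [x0 <-] := angle_of_surj t0 => m0.
have p0 := pi_gt0 R.
pose K := `[x0 - pi, x0 + pi]%classic `&` [set x | 0 <= m (ang x)].
have Kx0 : K x0 by split=> //=; rewrite in_itv/=; apply/andP; split; lra.
have cK : compact K.
  apply: compact_closedI; first exact: segment_compact.
  apply: (@preimage_closed _ _ (m \o ang) [set y | 0 <= y]); last exact: closed_ge.
  by move=> x _; apply: continuous_comp; [exact: angle_of_continuous|exact: m_cont].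
have cid : {within K, continuous (@idfun R)}.
  by apply: continuous_subspaceT => x.
have [B BK Bmax] := compact_EVT_max (ex_intro _ _ Kx0) cK cid.
have [A AK Amin] := compact_EVT_min (ex_intro _ _ Kx0) cK cid.
have {Bmax}Bmax x : K x -> x <= B by move=> Kx; apply: Bmax; rewrite inE.
have {Amin}Amin x : K x -> A <= x by move=> Kx; apply: Amin; rewrite inE.
move: AK BK; rewrite !inE => -[/= + mA] [/= + mB].
rewrite !in_itv/= => /andP[A1 A2] /andP[B1 B2].
have far (a : R) : 0 <= m (ang a) -> 0 <= m (ang (a + pi)) -> False.
  move=> ma mp; have hp : 0 < (pi / 2 : R) < pi by apply/andP; split; lra.
  by have := m_antipodal hp ma mp; have := mle (ang (a + pi / 2)); lra.
have xA : x0 - A < pi.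
  rewrite ltNge; apply/negP => h; apply: (far A) => //.
  by rewrite (_ : A + pi = x0)//; lra.
have xB : B - x0 < pi.
  rewrite ltNge; apply/negP => h; apply: (far x0) => //.
  by rewrite (_ : x0 + pi = B)//; lra.
have Ax0 := Amin _ Kx0; have Bx0 := Bmax _ Kx0.
have mAB x : A <= x -> x <= B -> 0 <= m (ang x).
  move=> Ax xB'; case: (leP x x0) => xx0.
    exact: (concave_between Ax xx0).
  exact: (concave_between (ltW xx0) xB').
have BA : B < A + pi.
  rewrite ltNge; apply/negP => h; apply: (far A) => //.
  by apply: mAB => //; lra.
exists A, B; split=> //; first exact: le_trans Bx0.
apply/seteqP; split=> t /=.
  move=> mt; have [x [xE xx0 _]] := adist_rep t x0.
  have : `|x - x0| <= pi by rewrite xx0; exact: adist_le_pi.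
  rewrite ler_norml => /andP[h1 h2]; exists x => //=.
  have Kx : K x by split; rewrite /= ?xE// in_itv/=; apply/andP; split; lra.
  by rewrite Amin ?Bmax.
by move=> [x /= /andP[Ax xB']] <-; exact: mAB.
Qed.
End trigonometric_concavity.

(** * Uniform convergence of the empirical folded moment *)

Section uniform_law.
Context {d : measure_display} {Omega : measurableType d}.
Variables (P : probability Omega R) (mu : probability (borel_kale alpha) R).
Hypothesis mu_moment :
  (\int[mu]_(p in [set: borel_kale alpha]) (kdist origin p)%:E < +oo)%E.
Variable p : nat -> {RV P >-> borel_kale alpha}.
Hypothesis p_indep : mutually_independent P (fun n => p n : Omega -> borel_kale alpha).
Hypothesis p_distr : forall (n : nat) (A : set (borel_kale alpha)),
  measurable A -> distribution P (p n) A = mu A.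

Lemma pairwise_independent (i j : nat) (A B : set (borel_kale alpha)) :
  i != j -> measurable A -> measurable B ->
  P (p i @^-1` A `&` p j @^-1` B) = (mu A * mu B)%E.
Proof.
move=> ij mA mB.
have := p_indep (J := [:: i; j]) (A := fun k => if k == i then A else B).
rewrite /= inE ij => /(_ isT) H.
have mAB k : measurable (if k == i then A else B) by case: ifP.
have {}H := H mAB.
rewrite !big_cons big_nil mule1 eqxx eq_sym (negbTE ij) in H.
rewrite -(p_distr i mA) -(p_distr j mB) -H; congr (P _).
apply/seteqP; split=> w /=.
  move=> [Aw Bw] k /=; rewrite !inE => /orP[] /eqP ->; rewrite ?eqxx//.
  by rewrite eq_sym (negbTE ij).
move=> H'; split.
  by have := H' i; rewrite /= !inE eqxx => /(_ isT).
by have := H' j; rewrite /= !inE eqxx orbT eq_sym (negbTE ij) => /(_ isT).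
Qed.

Lemma lln_radius :
  {ae P, forall w, (\sum_(i < N) kdist origin (p i w)) / N%:R @[N --> \oo]
    --> \int[mu]_q kdist origin q}.
Proof.
apply: (lln_ge0 p_distr pairwise_independent).
- exact: measurable_radius.
- exact: kdist_ge0.
- exact: integrable_radius.
Qed.

(** Adding the radius makes the folded coordinate nonnegative, so that [lln_ge0] applies; the law
    for the radius is then subtracted. *)
Lemma lln_fold1 (t : angle alpha) :
  {ae P, forall w, mean_fold1 N (fun n => p n w) t @[N --> \oo]
    --> (folded_moment mu t).1}.
Proof.
have h0 (q : kale alpha) : 0 <= kdist origin q + (fold t q).1.
  by have := norm_fold1_le t q; rewrite ler_norml => /andP[]; lra.
have ih : mu.-integrable [set: borel_kale alpha]
    (EFin \o (fun q => kdist origin q + (fold t q).1)).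
  exact: integrableD (integrable_radius mu_moment) (integrable_fold1 mu_moment t).
have mh : measurable_fun [set: borel_kale alpha]
    (fun q : borel_kale alpha => kdist origin q + (fold t q).1).
  by apply: measurable_funD; [exact: measurable_radius|exact: measurable_fold1].
have := lln_ge0 p_distr pairwise_independent mh h0 ih.
rewrite RintegralD//; [|exact: integrable_radius|exact: integrable_fold1].
move: lln_radius; apply: filterS2 => w H1 H2.
rewrite (_ : (fun N => _) = (fun N =>
  (\sum_(i < N) (kdist origin (p i w) + (fold t (p i w)).1)) / N%:R -
  (\sum_(i < N) kdist origin (p i w)) / N%:R)); last first.
  by apply/funext => N; rewrite big_split mulrDl [RHS]addrAC subrr add0r.
rewrite [X in _ --> X](_ : _ = \int[mu]_q kdist origin q
    + \int[mu]_q (fold t q).1 - \int[mu]_q kdist origin q).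
  exact: cvgB H2 H1.
by rewrite addrAC subrr add0r.
Qed.

Let measurable_mean (f : borel_kale alpha -> R) N :
  measurable_fun [set: borel_kale alpha] f ->
  measurable_fun setT (fun w => (\sum_(i < N) f (p i w)) / N%:R).
Proof.
move=> mf; apply: measurable_funM => //; apply: measurable_sum => i.
exact: measurableT_comp.
Qed.

Lemma uniform_lln (e : R) : 0 < e -> exists Nstar : {RV P >-> nat},
  {ae P, forall w, forall N, (Nstar w <= N)%N -> (0 < N)%N /\ forall t,
    `|mean_fold1 N (fun n => p n w) t - (folded_moment mu t).1| < e}.
Proof.
move=> e0; set C := \int[mu]_q kdist origin q.
have C0 : 0 <= C by apply: Rintegral_ge0 => q _; exact: kdist_ge0.
(* Passing to the nearest net point costs at most [e / 4] for the empirical moment, whose Lipschitz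
   constant is eventually at most [C + 1], and [e / 4] for the true one; [e / 2] remains for the
   error at the net points. *)
have r0 : 0 < e / (4 * (C + 1)) by rewrite divr_gt0// mulr_gt0// ltr_wpDl.
have [M [x net]] := angle_net r0.
pose f N w t := mean_fold1 N (fun n => p n w) t.
pose mf t := (folded_moment mu t).1.
(* The condition [0 < N] makes the index exclude the empty sample, whose barycenter is arbitrary. *)
pose E N : set Omega := [set w | (0 < N)%N] `&`
  ([set w | (\sum_(i < N) kdist origin (p i w)) / N%:R <= C + 1] `&`
   \bigcap_(k in `I_M) ~` [set w | e / 2 <= `|f N w (ang (x k)) - mf (ang (x k))|]).
have mE N : measurable (E N).
  apply: measurableI.
    rewrite (_ : mkset _ = if (0 < N)%N then setT else set0); first by case: ifP.
    by case: (0 < N)%N; apply/seteqP; split.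
  apply: measurableI.
    rewrite -[X in measurable X]setTI.
    apply: (measurable_fun_le measurableT); last exact: measurable_cst.
    exact: measurable_mean measurable_radius.
  apply: bigcap_measurableType => k _; apply: measurableC.
  apply: measurable_norm_ge; apply: measurable_funB => //.
  exact: measurable_mean (measurable_fold1 _).
have aeE : {ae P, forall w, \forall N \near \oo, E N w}.
  have : {ae P, forall w, forall k, f N w (ang (x k)) @[N --> \oo] --> mf (ang (x k))}.
    by apply: ae_foralln => k; exact: lln_fold1.
  move: lln_radius; apply: filterS2 => w H1 H2.
  have near_net : forall K, \forall N \near \oo, forall k, (k < K)%N ->
      `|f N w (ang (x k)) - mf (ang (x k))| < e / 2.
    elim=> [|K IH]; first by apply: nearW.
    have /cvgrPdist_lt/(_ (e / 2)) := H2 K; rewrite divr_gt0// => /(_ isT) HK.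
    near=> N => k; rewrite ltnS leq_eqVlt => /predU1P[->|kK].
      by rewrite distrC; near: N.
    by move: k kK; near: N.
  near=> N; split; first by near: N; exact: nbhs_infty_gt.
  split; last first.
    move=> k /= kM; apply/negP; rewrite -ltNge; move: k kM.
    by near: N; exact: near_net.
  have : `|C - (\sum_(i < N) kdist origin (p i w)) / N%:R| < 1.
    by near: N; move/cvgrPdist_lt : H1; apply.
  by rewrite ltr_norml /= => /andP[? ?]; lra.
have [Nstar HN] := eventually_index_RV mE aeE; exists Nstar.
move: HN; apply: filterS => w HN N /HN[/= N0 [NC Nk]]; split=> // t.
have [k kM tk] := net t.
have /= /negP := Nk k kM; rewrite -ltNge => H1.
have H2 := mean_fold1_lip (fun n => p n w) N0 t (ang (x k)).
have H3 := folded_moment_lip mu_moment t (ang (x k)).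
have d0 := adist_ge0 t (ang (x k)).
have H4 : (C + 1) * adist t (ang (x k)) <= e / 4.
  have -> : e / 4 = (C + 1) * (e / (4 * (C + 1))).
    by field; rewrite gt_eqF// ltr_wpDl.
  by rewrite ler_wpM2l// addr_ge0.
have H5 : (\sum_(i < N) kdist origin (p i w)) / N%:R * adist t (ang (x k)) <= e / 4.
  by apply: le_trans H4; rewrite ler_wpM2r.
have H6 : C * adist t (ang (x k)) <= e / 4.
  by apply: le_trans H4; rewrite ler_wpM2r// lerDl.
rewrite -/(f N w t) -/(mf t).
rewrite (_ : f N w t - mf t = (f N w t - f N w (ang (x k))) +
  (f N w (ang (x k)) - mf (ang (x k))) + (mf (ang (x k)) - mf t)); last by ring.
have /le_trans/(_ H5) H2' := H2; have /le_trans/(_ H6) H3' := H3.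
apply: le_lt_trans (ler_normD _ _) _.
apply: (@lt_le_trans _ _ (e / 4 + e / 2 + e / 4)); last by lra.
apply: ltr_leD; last by rewrite distrC.
by apply: le_lt_trans (ler_normD _ _) _; rewrite ler_ltD.
Unshelve. all: by end_near. Qed.

(** The tolerances [1 / (j + 1)] yield a null set that does not depend on [e]. *)
Lemma uniform_lln_ae :
  {ae P, forall w, forall e : R, 0 < e -> \forall N \near \oo, (0 < N)%N /\ forall t,
    `|mean_fold1 N (fun n => p n w) t - (folded_moment mu t).1| < e}.
Proof.
have : {ae P, forall w, forall j, \forall N \near \oo, (0 < N)%N /\ forall t,
    `|mean_fold1 N (fun n => p n w) t - (folded_moment mu t).1| < j.+1%:R^-1}.
  apply: ae_foralln => j; have j0 : 0 < j.+1%:R^-1 :> R by rewrite invr_gt0 ltr0n.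
  have [Nstar] := uniform_lln j0; apply: filterS => w H.
  by exists (Nstar w) => // N; exact: H.
apply: filterS => w H e e0.
have je : (Num.truncn e^-1).+1%:R^-1 < e.
  by rewrite invf_plt ?posrE ?ltr0n//; exact: truncnS_gt.
have := H (Num.truncn e^-1); apply: filterS => N [N0 HN]; split=> // t.
exact: lt_trans je.
Qed.
End uniform_law.

Lemma gap_on_closed (g : angle alpha -> R) (C c : R) (D : set (angle alpha)) :
  (forall t t', `|g t - g t'| <= C * adist t t') -> closed D ->
  (forall t, D t -> g t < c) -> exists2 e, 0 < e & forall t, D t -> g t <= c - e.
Proof.
move=> gC cD gc; case: (pselect (D !=set0)) => [D0|D0]; last first.
  by exists 1 => // t Dt; exfalso; apply: D0; exists t.
have [t Dt tmax] := angle_argmax gC cD D0; exists (c - g t).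
  by rewrite subr_gt0 gc.
by move=> t' /tmax; lra.
Qed.

Lemma far_angles_closed (t0 : angle alpha) (r : R) :
  closed [set t | r <= adist t t0].
Proof.
apply: (@preimage_closed _ _ (fun t => adist t t0) [set y | r <= y]);
  last exact: closed_ge.
move=> t _; apply: (@angle_lip_continuous _ 1) => u v.
have := adist_triangle u v t0; have := adist_triangle v u t0.
by rewrite (adistC v u) mul1r ler_norml => ? ?; apply/andP; split; lra.
Qed.

Lemma clipped_cos_diag (t : angle alpha) : clipped_cos t t = 1.
Proof.
have [x <-] := angle_of_surj t.
by rewrite clipped_cosE ?subrr ?normr0 ?pi_ge0// cos0.
Qed.

(** The radial part of the squared distance is below [e^2 / 4]. As [r < 2 * s], the angular part is
    at most [4 * s^2] times the angular distance, hence at most [e^2 / 2]. *)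
Lemma kdist_lt (r s : {r : R | 0 < r}) (t u : angle alpha) (e : R) : 0 < e ->
  `|val r - val s| < e / 2 -> `|val r - val s| < val s ->
  adist t u <= e ^+ 2 / (8 * val s ^+ 2) ->
  kdist (Some (r, t)) (Some (s, u)) < e.
Proof.
move=> e0 rs1 rs2 tu; have s0 : 0 < val s := valP s; have r0 : 0 < val r := valP r.
rewrite -(@ltr_pXn2r _ 2) ?nnegrE ?kdist_ge0 ?(ltW e0)//.
rewrite kdist_sqr_clipped_cos.
have c1 : 1 - clipped_cos t u <= adist t u.
  rewrite -(clipped_cos_diag t); apply: le_trans (ler_norm _) _.
  apply: le_trans (clipped_cos_lip t t u) _; exact: lexx.
have h1 : (val r - val s) ^+ 2 < e ^+ 2 / 4.
  move: rs1; rewrite ltr_norml => /andP[? ?]; nra.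
have h2 : val r < 2 * val s by move: rs2; rewrite ltr_norml => /andP[? ?]; lra.
have h3 : 2 * val r * val s * (1 - clipped_cos t u) <= e ^+ 2 / 2.
  have -> : e ^+ 2 / 2 = 2 * (2 * val s) * val s * (e ^+ 2 / (8 * val s ^+ 2)).
    by field; rewrite gt_eqF.
  apply: (@le_trans _ _ (2 * val r * val s * (e ^+ 2 / (8 * val s ^+ 2)))).
    by rewrite ler_wpM2l ?(le_trans c1)// !mulr_ge0// ltW.
  have p0 : 0 <= e ^+ 2 / (8 * val s ^+ 2).
    by rewrite divr_ge0 ?sqr_ge0// mulr_ge0// sqr_ge0.
  by rewrite (ler_wpM2r p0)// ler_wpM2r ?(ltW s0)// ler_wpM2l// ltW.
have := sqr_ge0 e; have : 0 < e ^+ 2 by rewrite exprn_gt0.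
lra.
Qed.
End angles.

(** * Limits of the barycenters *)

Section limits.
Context {R : realType} (alpha : R).
Hypothesis halpha : 2 * pi < alpha.
Variable mu : probability (borel_kale alpha) R.
Hypothesis mu_nondeg : nondegenerate_measure mu.
Hypothesis mu_moment :
  (\int[mu]_(p in [set: borel_kale alpha]) (kdist origin p)%:E < +oo)%E.
Context {d : measure_display} {Omega : measurableType d}.
Variable P : probability Omega R.
Variable p : nat -> {RV P >-> borel_kale alpha}.
Hypothesis p_indep : mutually_independent P (fun n => p n : Omega -> borel_kale alpha).
Hypothesis p_distr : forall (n : nat) (A : set (borel_kale alpha)),
  measurable A -> distribution P (p n) A = mu A.

Let m (t : angle alpha) : R := (folded_moment mu t).1.
Let b (N : nat) (w : Omega) : kale alpha := barycenter N (fun n => p n w).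
Let f (N : nat) (w : Omega) : angle alpha -> R := mean_fold1 N (fun n => p n w).

Let m_lip t t' : `|m t - m t'| <= (\int[mu]_q kdist origin q) * adist t t'.
Proof. exact: folded_moment_lip. Qed.

Let m_cont : continuous m.
Proof. exact: (angle_lip_continuous halpha m_lip). Qed.

Let unif_index e (e0 : 0 < e) := uniform_lln halpha mu_moment p_indep p_distr e0.
Let unif_ae := uniform_lln_ae halpha mu_moment p_indep p_distr.

(** By compactness [m] stays below some [- e] on [D], so the empirical moment is eventually negative
    there, whereas its value in the direction of a barycenter is the radius, which is positive. It
    is applied to the whole circle in the fully sticky case and to the complement of an open arc in
    the partly sticky one. *)
Lemma barycenter_avoids (D : set (angle alpha)) : closed D ->
  (forall t, D t -> m t < 0) ->
  exists Nstar : {RV P >-> nat}, {ae P, forall w, forall N, (Nstar w <= N)%N ->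
    b N w = origin \/ exists s t, ~ D t /\ b N w = Some (s, t)}.
Proof.
move=> cD mD; have [e e0 mDe] := gap_on_closed halpha m_lip cD mD.
have [Nstar HN] := unif_index e0; exists Nstar.
move: HN; apply: filterS => w HN N /HN[N0 fN]; rewrite /b.
have [[-> _]|[s [t [-> ft _]]]] := barycenterP halpha (fun n => p n w) N0.
  by left.
right; exists s, t; split=> // Dt; have s0 := valP s; rewrite -ft in s0.
have := fN t; have := mDe t Dt; rewrite ltr_norml -/(m t) => h1 /andP[_ h2].
by move: s0; rewrite /= in h2 *; lra.
Qed.

Lemma fully_sticky_limit : fully_sticky mu ->
  exists Nstar : {RV P >-> nat}, {ae P, forall w,
    forall N, (Nstar w <= N)%N -> b N w = origin}.
Proof.
move=> fs; have mlt t : [set: angle alpha] t -> m t < 0.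
  move=> _; rewrite ltNge; apply/negP => mt.
  by have : nonneg_angles mu t by []; rewrite fs.
have [Nstar HN] := barycenter_avoids closedT mlt; exists Nstar.
by move: HN; apply: filterS => w HN N /HN[//|[s [t [/(_ I)]]]].
Qed.

(** Here [m <= 0] everywhere, so the radius of the barycenter, a value of the empirical moment, is
    at most the uniform error. *)
Lemma partly_sticky_limit : partly_sticky mu ->
  {ae P, forall w, kdist (b N w) origin @[N --> \oo] --> (0 : R)}.
Proof.
move=> [_ ps]; have mle t : m t <= 0.
  by rewrite leNgt; apply/negP => mt; have := ps t (ltW mt); rewrite -/(m t); lra.
move: unif_ae; apply: filterS => w H; apply/cvgrPdist_lt => e e0.
have := H e e0; apply: filterS => N [N0 fN].
rewrite sub0r normrN ger0_norm ?kdist_ge0// /b.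
have [[-> _]|[s [t [-> ft _]]]] := barycenterP halpha (fun n => p n w) N0 => //.
have := fN t; rewrite ltr_norml ft -/(m t) => /andP[_ h] /=.
by have := mle t; move: h => /=; lra.
Qed.

Lemma origin_in_sector (I : set (angle alpha)) : I !=set0 -> sector I origin.
Proof.
by move=> [t It]; have [r r0 rE] := ray_origin t; exists r, t.
Qed.

Lemma partly_sticky_arc : partly_sticky mu ->
  exists A B : R,
    [/\ A <= B, B < A + pi, nonneg_angles mu = closed_arc alpha A B &
        forall x y : R, closed_arc alpha A B `<=` open_arc alpha x y ->
          exists Nstar : {RV P >-> nat}, {ae P, forall w,
            forall N : nat, (Nstar w <= N)%N ->
              sector (open_arc alpha x y) (b N w)}].
Proof.
move=> [[t0 mt0] ps]; have mle t : m t <= 0.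
  by rewrite leNgt; apply/negP => mt; have := ps t (ltW mt); rewrite -/(m t); lra.
have [A [B [AB BA KE]]] := concave_nonpos_arc halpha
  (folded_moment_concave halpha mu_moment) (folded_moment_far halpha mu_nondeg mu_moment)
  (folded_moment_antipodal halpha mu_nondeg mu_moment) m_cont mle
  (ex_intro (fun t => 0 <= m t) t0 mt0).
exists A, B; split=> // x y xy.
have mD t : (~` open_arc alpha x y) t -> m t < 0.
  move=> nt; rewrite ltNge; apply/negP => mt; apply/nt/xy.
  by rewrite -KE.
have oxy : open (open_arc alpha x y) by exact: open_arc_open.
have [Nstar HN] := barycenter_avoids (open_closedC oxy) mD.
exists Nstar; move: HN; apply: filterS => w HN N /HN[->|[s [t [nt ->]]]].
  apply: origin_in_sector; exists (angle_of alpha A); apply: xy.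
  by exists A => //=; rewrite lexx.
have [r r0 rE] := ray_polar s t; exists r, t; split=> //.
exact: contrapT.
Qed.

Lemma nonsticky_limit : nonsticky mu ->
  exists bbar : kale alpha,
    [/\ is_mean mu bbar, bbar <> origin &
        {ae P, forall w, kdist (b N w) bbar @[N --> \oo] --> (0 : R)}].
Proof.
move=> ns; have [[t1 t1int] nspos] := ns.
have mt1 : 0 < m t1 by exact: nspos.
have [t0 _ t0max] := angle_argmax halpha m_lip closedT (ex_intro _ t1 I).
have m0 : 0 < m t0 by apply: lt_le_trans mt1 _; exact: t0max.
have {}t0max u : m u <= m t0 by exact: t0max.
have t0uniq t' : m t' = m t0 -> t' = t0.
  exact: (concave_max_unique halpha (folded_moment_concave halpha mu_moment)
    (folded_moment_far halpha mu_nondeg mu_moment) m0 t0max).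
have t0lt t' : t' <> t0 -> m t' < m t0.
  by move=> t't0; rewrite lt_neqAle t0max andbT; apply/eqP => /t0uniq.
pose s0 : {r : R | 0 < r} := exist (fun r : R => 0 < r) _ m0.
exists (Some (s0, t0)); split=> //.
  right; split=> //; exists t0; first exact: t0lt.
  by rewrite /polar (_ : (folded_moment mu t0).1 = val s0)// valK.
move: unif_ae; apply: filterS => w H; apply/cvgrPdist_lt => e e0.
pose r := e ^+ 2 / (8 * m t0 ^+ 2).
have r0 : 0 < r by rewrite divr_gt0 ?mulr_gt0 ?exprn_gt0.
have mD t : [set t | r <= adist t t0] t -> m t < m t0.
  move=> /= rt; apply: t0lt => tt0; move: rt.
  have [x xE] := angle_of_surj t0.
  have := adist_le alpha x x; rewrite tt0 xE subrr normr0; lra.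
have cD : closed [set t | r <= adist t t0] by exact: far_angles_closed.
have [g g0 mDg] := gap_on_closed halpha m_lip cD mD.
(* The first two bounds serve the radial hypotheses of [kdist_lt]. The third gives [m t > m t0 - g]
   at the direction [t] of the barycenter, which forces [t] to be within [r] of [t0]. *)
pose e' := Num.min (Num.min (e / 2) (m t0)) (g / 2).
have e'0 : 0 < e' by rewrite !lt_min m0 !divr_gt0.
have [e'e e'm e'g] : [/\ e' <= e / 2, e' <= m t0 & e' <= g / 2].
  by split; rewrite /e' !ge_min lexx ?orbT.
have := H e' e'0; apply: filterS => N [N0 fN].
rewrite sub0r normrN ger0_norm ?kdist_ge0// /b.
have := fN t0; rewrite ltr_norml -/(m t0) => /andP[f1 f2].
have [[_ le0]|[s [t [-> ft tmax]]]] := barycenterP halpha (fun n => p n w) N0.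
  by have := le0 t0; lra.
have := fN t; rewrite ltr_norml ft -/(m t) => /andP[_ f4].
have := tmax t0; rewrite ft => f5.
have [s_near mt_near] := max_perturbation f1 f5 f4 (t0max t).
apply: kdist_lt => //.
- exact: lt_le_trans s_near e'e.
- exact: lt_le_trans s_near e'm.
- rewrite leNgt; apply/negP => rt; have := mDg t (ltW rt).
  rewrite leNgt => /negP; apply; apply: le_lt_trans mt_near.
  by rewrite lerD2l lerN2 -ler_pdivlMl// mulrC.
Qed.

(** Exclusiveness is immediate from the definitions. If neither sticky case holds, [m] is positive
    somewhere, and trigonometric concavity carries positivity to the whole interior of the
    nonnegative set. *)
Lemma sticky_trichotomy :
  exactly_one (fully_sticky mu) (partly_sticky mu) (nonsticky mu).
Proof.
have fp : fully_sticky mu -> ~ partly_sticky mu.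
  by move=> fs [[t]]; rewrite fs.
have fn : fully_sticky mu -> ~ nonsticky mu.
  by move=> fs [[t /interior_subset]]; rewrite fs.
have pn : partly_sticky mu -> ~ nonsticky mu.
  move=> [_ ps] [[t tint] ns]; have := ns t tint.
  by rewrite (ps t (interior_subset tint)) ltxx.
case: (pselect (fully_sticky mu)) => fs.
  by apply: Or31; split=> //; [exact: fp|exact: fn].
case: (pselect (partly_sticky mu)) => ps.
  by apply: Or32; split=> //; exact: pn.
apply: Or33; split=> //.
have [t mt] : nonneg_angles mu !=set0 by apply/set0P/eqP.
have [t' mt'] : exists t', 0 < m t'.
  apply: contrapT => nt; apply: ps; split; first by exists t.
  move=> u mu0; apply/eqP; rewrite eq_le mu0 andbT leNgt; apply/negP => mu1.
  by apply: nt; exists u.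
exact: (concave_pos_interior halpha (folded_moment_concave halpha mu_moment)
  (folded_moment_far halpha mu_nondeg mu_moment) m_cont mt').
Qed.
End limits.

Unset Implicit Arguments.

Theorem theorem1p12 (R : realType) (alpha : R) (halpha : 2 * pi < alpha)
  (mu : probability (borel_kale alpha) R)
  (mu_nondeg : nondegenerate_measure mu)
  (mu_moment :
    (\int[mu]_(p in [set: borel_kale alpha]) (kdist origin p)%:E < +oo)%E)
  (d : measure_display) (Omega : measurableType d) (P : probability Omega R)
  (p : nat -> {RV P >-> borel_kale alpha})
  (p_indep : mutually_independent P (fun n => p n : Omega -> borel_kale alpha))
  (p_distr : forall (n : nat) (A : set (borel_kale alpha)),
    measurable A -> distribution P (p n) A = mu A) :
  let b (N : nat) (omega : Omega) : kale alpha :=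
    barycenter N (fun n => p n omega) in
  exactly_one
    [/\ fully_sticky mu, is_mean mu origin &
        exists Nstar : {RV P >-> nat}, {ae P, forall omega,
          forall N : nat, (Nstar omega <= N)%N -> b N omega = origin}]
    [/\ partly_sticky mu, is_mean mu origin,
        {ae P, forall omega, kdist (b N omega) origin @[N --> \oo] --> (0 : R)} &
        exists A B : R,
          [/\ A <= B, B < A + pi, nonneg_angles mu = closed_arc alpha A B &
              forall x y : R, closed_arc alpha A B `<=` open_arc alpha x y ->
                exists Nstar : {RV P >-> nat}, {ae P, forall omega,
                  forall N : nat, (Nstar omega <= N)%N ->
                    sector (open_arc alpha x y) (b N omega)}]]
    (nonsticky mu /\
     exists bbar : kale alpha,
       [/\ is_mean mu bbar, bbar <> origin &
           {ae P, forall omega,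
              kdist (b N omega) bbar @[N --> \oo] --> (0 : R)}]).
Proof.
move=> b.
have fl := fully_sticky_limit halpha mu_moment p_indep p_distr.
have pl := partly_sticky_limit halpha mu_moment p_indep p_distr.
have pa := partly_sticky_arc halpha mu_nondeg mu_moment p_indep p_distr.
have nl := nonsticky_limit halpha mu_nondeg mu_moment p_indep p_distr.
(* The three alternatives already exclude one another through their first components. *)
case: (sticky_trichotomy halpha mu_nondeg mu_moment) => -[h1 h2 h3].
- apply: Or31; split.
  + by split; [|by left; split=> //; left|exact: fl].
  + by case.
  + by case.
- apply: Or32; split.
  + by case.
  + by split; [|by left; split=> //; right|exact: pl|exact: pa].
  + by case.
- apply: Or33; split.
  + by case.
  + by case.
  + by split=> //; exact: nl.
Qed.
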